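(* Let $p=\min(n,m)$. The function $u$ is convex on $B_{JX}(P_0)\subset\mathbb{U}\subset\mathbf{G}_{n,m}$, and $$\mathrm{Hess}(u)\ \ge\ \left(2-\tfrac12u^2\right)g+\frac{\left(3+\tfrac14p^2\right)u+4p}{2(u+p)^2}\,du\otimes du$$ (as an inequality of quadratic forms on tangent spaces) at every point of $\{P\in\mathbb{U}: u(P)\le 2\}$.
   Context: $\mathbf{G}_{n,m}$ is the Grassmannian manifold of oriented $n$-dimensional subspaces of $\mathbb{R}^{n+m}$. Fix $P_0\in\mathbf{G}_{n,m}$, spanned by an oriented orthonormal basis $\varepsilon_1,\dots,\varepsilon_n$, and complete it by $\varepsilon_{n+1},\dots,\varepsilon_{n+m}$ to an orthonormal basis of $\mathbb{R}^{n+m}$. For $P\in\mathbf{G}_{n,m}$ with oriented orthonormal basis $e_1,\dots,e_n$ put $w(P)=\langle e_1\wedge\cdots\wedge e_n,\varepsilon_1\wedge\cdots\wedge\varepsilon_n\rangle=\det(\langle e_i,\varepsilon_j\rangle)$, and let $\mathbb{U}=\{P\in\mathbf{G}_{n,m}: w(P)>0\}$. Every $P\in\mathbb{U}$ is spanned by $\varepsilon_i+\sum_{\alpha} z_{i\alpha}\varepsilon_{n+\alpha}$, $1\le i\le n$, for a unique $n\times m$ matrix $Z=(z_{i\alpha})$, and $Z$ serves as a global coordinate on $\mathbb{U}$. The canonical metric on $\mathbf{G}_{n,m}$ is, on $\mathbb{U}$, $g=\mathrm{tr}\big((I_n+ZZ^T)^{-1}dZ\,(I_m+Z^TZ)^{-1}dZ^T\big)$;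 $\mathrm{Hess}$ denotes the Hessian with respect to the Levi-Civita connection of $g$. The Jordan angles between $P\in\mathbb{U}$ and $P_0$ are $\theta_1,\dots,\theta_p\in[0,\pi/2)$, $p=\min(n,m)$, where $\tan\theta_1,\dots,\tan\theta_p$ are the singular values of $Z$ (with multiplicity). Equivalently, $\cos^2\theta_\alpha$ are the eigenvalues of $W^TW$ with $W=(\langle e_i,\varepsilon_j\rangle)$, apart from $n-p$ additional eigenvalues equal to $1$. $B_{JX}(P_0)\subset\mathbb{U}$ is the set of $P$ such that the sum of any two Jordan angles between $P$ and $P_0$ (that is, $\theta_\alpha+\theta_\beta$ for $\alpha\ne\beta$) is less than $\pi/2$. The function $u:\mathbb{U}\to[0,\infty)$ is $u=\sum_\alpha\tan^2\theta_\alpha=\mathrm{tr}(ZZ^T)$. ''Convex'' means that the Hessian is nonnegative definite. *)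

(* Defs.v *)
From HB Require Import structures.
From mathcomp Require Import all_boot all_order all_algebra.
From mathcomp Require Import generic_quotient.
From mathcomp Require Import ring.
From mathcomp Require Import all_classical all_reals all_analysis.

Set Implicit Arguments.
Unset Strict Implicit.
Unset Printing Implicit Defensive.

Import Order.TTheory GRing.Theory Num.Theory.
Import numFieldNormedType.Exports.
Local Open Scope quotient_scope.
Local Open Scope classical_set_scope.
Local Open Scope ring_scope.

(* Vectors are row vectors: the rows of a frame are e_1, ..., e_k. *)
Record oframe (R : realType) (k N : nat) := OFrame {
  ofmx :> 'M[R]_(k, N);
  oframe_orthonormal : ofmx *m ofmx^T == 1%:M }.

HB.instance Definition _ (R : realType) (k N : nat) :=
  [isSub for @ofmx R k N].
HB.instance Definition _ (R : realType) (k N : nat) :=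
  [Choice of oframe R k N by <:].

Section Grassmannian.
Context (R : realType) (n m : nat).
Implicit Types E F : oframe R n (n + m).

Lemma oframeK E : E *m E^T = 1%:M.
Proof. exact/eqP/oframe_orthonormal. Qed.

(* Same row space and same orientation. *)
Definition same_plane E F : bool :=
  (ofmx E == ofmx F)%MS && (0 < \det (E *m F^T)).

Lemma same_plane_refl : reflexive same_plane.
Proof. by move=> E; rewrite /same_plane submx_refl oframeK det1 ltr01. Qed.

Lemma same_plane_sym : symmetric same_plane.
Proof.
move=> E F; rewrite /same_plane [X in X && _]andbC; congr (_ && (0 < _)).
by rewrite -det_tr trmx_mul trmxK.
Qed.

Lemma same_plane_trans : transitive same_plane.
Proof.
move=> F E G /andP[/eqmxP EF dEF] /andP[/eqmxP FG dFG].
rewrite /same_plane; apply/andP; split; first by apply/eqmxP/(eqmx_trans EF).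
have /submxP[A EA] : (ofmx E <= ofmx F)%MS by rewrite EF.
have dA : 0 < \det A by move: dEF; rewrite EA -mulmxA oframeK mulmx1.
by rewrite EA -mulmxA det_mulmx mulr_gt0.
Qed.

Canonical same_plane_equiv :=
  EquivRel same_plane same_plane_refl same_plane_sym same_plane_trans.

(* Oriented n-dimensional subspaces of R^(n+m). *)
Definition grass := {eq_quot same_plane}.
HB.instance Definition _ := EqQuotient.on grass.
HB.instance Definition _ := Choice.on grass.

End Grassmannian.

Section Riemannian.
Context (R : realType) (N : nat).
Implicit Types (G : 'rV[R]_N -> 'M[R]_N) (f : 'rV[R]_N -> R) (x : 'rV[R]_N).

Definition partial (i : 'I_N) f x : R := 'D_(delta_mx 0 i) f x.

(* Christoffel symbol Gamma^k_ij of the Levi-Civita connection of the metric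
   with components G in the given coordinates. *)
Definition christoffel G x (k i j : 'I_N) : R :=
  2^-1 * \sum_(l < N) invmx (G x) k l *
    (partial i (fun y => G y j l) x + partial j (fun y => G y i l) x
     - partial l (fun y => G y i j) x).

Definition hessian G f x (X Y : 'rV[R]_N) : R :=
  \sum_(i < N) \sum_(j < N) X 0 i * Y 0 j *
    (partial i (partial j f) x
     - \sum_(k < N) christoffel G x k i j * partial k f x).

Lemma christoffel_torsion_free G x k i j :
  (forall y, (G y)^T = G y) -> christoffel G x k i j = christoffel G x k j i.
Proof.
move=> Gsym; rewrite /christoffel; congr (_ * _); apply: eq_bigr => l _.
congr (_ * (_ - _)); first by rewrite addrC.
by congr (partial l _ x); apply: funext => y; rewrite -[in LHS]Gsym mxE.
Qed.

Lemma christoffel_lower G x i j l : G x \in unitmx ->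
  \sum_(k < N) G x l k * christoffel G x k i j =
  2^-1 * (partial i (fun y => G y j l) x + partial j (fun y => G y i l) x
          - partial l (fun y => G y i j) x).
Proof.
move=> Gu; set D := fun l => partial i (fun y => G y j l) x +
  partial j (fun y => G y i l) x - partial l (fun y => G y i j) x.
have -> : \sum_(k < N) G x l k * christoffel G x k i j =
    2^-1 * (G x *m (invmx (G x) *m \col_q D q)) l 0.
  rewrite mxE big_distrr /=; apply: eq_bigr => k _.
  rewrite /christoffel mxE mulrCA; congr (_ * (_ * _)).
  by apply: eq_bigr => q _; rewrite mxE.
by rewrite mulKVmx // mxE.
Qed.

Lemma christoffel_metric G x i j k :
  (forall y, (G y)^T = G y) -> G x \in unitmx ->
  partial k (fun y => G y i j) x =
  \sum_(l < N) christoffel G x l k i * G x l j +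
  \sum_(l < N) christoffel G x l k j * G x i l.
Proof.
move=> Gsym Gu.
have GC a b : (fun y => G y a b) = (fun y => G y b a).
  by apply: funext => y; rewrite -[in LHS]Gsym mxE.
under eq_bigr do rewrite mulrC -[G x]Gsym mxE.
under [X in _ = _ + X]eq_bigr do rewrite mulrC.
rewrite !christoffel_lower // (GC j i) (GC k i) (GC k j).
rewrite -mulrDr addrACA -(addrA (partial k _ x)) [X in X + _]addrC.
set a := partial k _ x; set b := partial i _ x; set c := partial j _ x.
by apply: (mulfI (_ : 2 != 0)); rewrite ?pnatr_eq0 // mulVKf ?pnatr_eq0 //; ring.
Qed.

End Riemannian.

Section GrassmannianChart.
Context (R : realType) (n m : nat).
Local Notation p := (minn n m).

(* An orthonormal basis of R^(n+m): the first n rows are an oriented basis of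
   P0, the last m rows complete it. *)
Variable eps : oframe R (n + m) (n + m).
Implicit Types (P : grass R n m) (X Y Z : 'M[R]_(n, m)).

Definition eps1 : 'M[R]_(n, n + m) := usubmx (ofmx eps).
Definition eps2 : 'M[R]_(m, n + m) := dsubmx (ofmx eps).

Lemma eps_orthonormal : [/\ eps1 *m eps1^T = 1%:M, eps1 *m eps2^T = 0,
  eps2 *m eps1^T = 0 & eps2 *m eps2^T = 1%:M].
Proof.
have /eqP := oframe_orthonormal eps.
rewrite -[ofmx eps]vsubmxK tr_col_mx mul_col_row (scalar_mx_block n m).
by move=> /eq_block_mx[].
Qed.

Lemma eps1_orthonormal : eps1 *m eps1^T == 1%:M.
Proof. by have [->] := eps_orthonormal. Qed.

Definition base_plane : grass R n m :=
  \pi_(grass R n m) (OFrame eps1_orthonormal).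

Definition w P : R := \det (ofmx (repr P) *m eps1^T).

Definition U : set (grass R n m) := [set P | 0 < w P].

(* P is spanned by eps_i + sum_a Z_ia eps_(n+a), 1 <= i <= n. *)
Definition spanned_by P Z : bool := (ofmx (repr P) == (eps1 + Z *m eps2)%R)%MS.

Definition coord P : 'M[R]_(n, m) := xget 0 [set Z | spanned_by P Z].

Lemma spanned_by_uniq P Z Z' : spanned_by P Z -> spanned_by P Z' -> Z = Z'.
Proof.
have [e11 e12 e21 e22] := eps_orthonormal.
move=> /eqmxP PZ /eqmxP PZ'.
have /submxP[A eA] : ((eps1 + Z *m eps2)%R <= (eps1 + Z' *m eps2)%R)%MS.
  by rewrite -PZ PZ'.
have A1 : A = 1%:M.
  have := congr1 (fun M => M *m eps1^T) eA.
  by rewrite /= -mulmxA !mulmxDl -!mulmxA e11 e21 !mulmx0 !addr0 mulmx1.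
have := congr1 (fun M => M *m eps2^T) eA.
by rewrite A1 mul1mx /= !mulmxDl -!mulmxA e12 e22 !mulmx1 !add0r.
Qed.

Lemma coordP P : U P -> spanned_by P (coord P).
Proof.
rewrite /U /= /w => wP; set E := ofmx (repr P) in wP *.
have Wu : E *m eps1^T \in unitmx by rewrite unitmxE unitfE gt_eqF.
suff: exists Z, spanned_by P Z by rewrite /coord; apply: xgetPex.
exists (invmx (E *m eps1^T) *m (E *m eps2^T)).
rewrite /spanned_by -/E.
have -> : eps1 + invmx (E *m eps1^T) *m (E *m eps2^T) *m eps2 =
    invmx (E *m eps1^T) *m E.
  have eps_eps : eps1^T *m eps1 + eps2^T *m eps2 = 1%:M.
    rewrite -mul_row_col -tr_col_mx vsubmxK.
    exact/mulmx1C/eqP/oframe_orthonormal.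
  rewrite -[X in _ = _ *m X]mulmx1 -eps_eps mulmxDr !mulmxDr.
  by rewrite !mulmxA -[X in X *m eps1]mulmxA mulVmx // mul1mx.
by apply/eqmxP/eqmx_sym/eqmxMfull; rewrite row_full_unit unitmx_inv.
Qed.

Lemma coord_inj P Q : U P -> U Q -> coord P = coord Q -> P = Q.
Proof.
move=> UP UQ PQ; have := coordP UP; have := coordP UQ; rewrite PQ.
move=> /eqmxP sQ /eqmxP sP.
have rPQ : (ofmx (repr P) :=: ofmx (repr Q))%MS.
  exact: eqmx_trans sP (eqmx_sym sQ).
rewrite -[P]reprK -[Q]reprK; apply/eqquotP; rewrite /= /same_plane.
apply/andP; split; first exact/eqmxP.
have /submxP[A eA] : (ofmx (repr P) <= ofmx (repr Q))%MS by rewrite rPQ.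
rewrite eA -mulmxA oframeK mulmx1.
move: UP UQ; rewrite /U /= /w eA -mulmxA det_mulmx => + UQ.
by rewrite pmulr_lgt0.
Qed.

(* Inverse of the chart [coord] on U. *)
Definition plane Z : grass R n m :=
  xget base_plane [set P | U P /\ coord P = Z].

Definition in_chart (f : grass R n m -> R) (z : 'rV[R]_(n * m)) : R :=
  f (plane (vec_mx z)).

(* s lists, with multiplicity, the p largest square roots of the eigenvalues of
   Z^T Z; the remaining m - p eigenvalues vanish. *)
Definition is_singular_values Z (s : 'I_p -> R) : Prop :=
  (forall a, 0 <= s a) /\
  char_poly (Z^T *m Z) = 'X^(m - p) * \prod_(a < p) ('X - (s a ^+ 2)%:P).

Definition is_jordan_angles P (theta : 'I_p -> R) : Prop :=
  (forall a, 0 <= theta a < pi / 2) /\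
  is_singular_values (coord P) (fun a => tan (theta a)).

(* For P in U the Jordan angles exist and are unique up to order; everything
   below is symmetric in them. *)
Definition jordan_angle P : 'I_p -> R :=
  xget (fun=> 0) [set theta | is_jordan_angles P theta].

Definition BJX : set (grass R n m) :=
  [set P | U P /\ forall a b : 'I_p, a != b ->
     jordan_angle P a + jordan_angle P b < pi / 2].

Definition u P : R := \sum_(a < p) tan (jordan_angle P a) ^+ 2.

Definition canonical_metric Z X Y : R :=
  \tr (invmx (1%:M + Z *m Z^T) *m X *m invmx (1%:M + Z^T *m Z) *m Y^T).

(* Tangent vectors at P are given by their components in the chart, as n x m
   matrices. *)
Definition g P X Y : R := canonical_metric (coord P) X Y.

Definition metric_components (z : 'rV[R]_(n * m)) : 'M[R]_(n * m) :=
  \matrix_(i, j) canonical_metric (vec_mx z)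
    (vec_mx (delta_mx 0 i)) (vec_mx (delta_mx 0 j)).

Definition differential (f : grass R n m -> R) P X : R :=
  'D_(mxvec X) (in_chart f) (mxvec (coord P)).

Definition Hess (f : grass R n m -> R) P X Y : R :=
  hessian metric_components (in_chart f) (mxvec (coord P)) (mxvec X) (mxvec Y).

End GrassmannianChart.

(* Main.v *)
From HB Require Import structures.
From mathcomp Require Import all_boot all_order all_algebra all_fingroup.
From mathcomp Require Import generic_quotient spectral complex.
From mathcomp Require Import ring lra.
From mathcomp Require Import all_classical all_reals all_analysis.
Require Import Defs.

(** In the coordinates Z one has u = tr (Z Z^T), because the tangents of the
Jordan angles are the singular values of Z (lemma [in_chart_u]). Differentiating
the metric gives the Christoffel map
Gamma(X, Y) = - (X Z^T A Y + Y Z^T A X), where A = (1 + Z Z^T)^-1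
(lemma [christoffel_gamma]), and hence
  Hess u (X, X) = 2 tr (X X^T) + 4 tr (X Z^T A X Z^T)
(lemma [hessian_sum_sqr]).

Let Z = V diag(s) W^T be a singular value decomposition and y = V^T X W. Then
(lemma [svd_forms])
  Hess u (X, X) = 2 Sum y_ij^2 + 4 Sum s_i s_j / (1 + s_j^2) y_ij y_ji,
  g (X, X) = Sum y_ij^2 / ((1 + s_i^2)(1 + s_j^2)),
  du (X) = 2 Sum s_a y_aa.
So the Hessian splits into the diagonal entries, with coefficient 2 + 2 c_aa, and
the pairs of entries y_ij, y_ji, which contribute at least
(2 - 2 c_ij)(y_ij^2 + y_ji^2), where c = [cross]. The number 1 - c_ij has the sign
of 1 - s_i s_j, which is positive exactly when the sum of the two Jordan angles
is less than pi / 2. This is the convexity on B_JX.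

Where u <= 2, the off-diagonal entries satisfy the second inequality without the
term in du (lemma [cross_bound]). Only the diagonal entries contribute to du. For
them the inequality follows from the Cauchy-Schwarz inequality once
  Sum phi (s_a^2) <= p phi (u / p),
for phi (t) = t (1 + t)^2 / (6 t^2 + 8 t + u^2/2). This is Jensen's inequality:
phi is concave on [0, u] when u <= 2 (lemmas [phi_tangent], [diag_bound]). *)

Set Implicit Arguments.
Unset Strict Implicit.
Unset Printing Implicit Defensive.

Import Order.TTheory GRing.Theory Num.Theory.
Import numFieldNormedType.Exports.

Local Open Scope quotient_scope.
Local Open Scope classical_set_scope.
Local Open Scope ring_scope.

(** * Inequalities between singular values *)

Lemma onesq_gt0 (R : realDomainType) (x : R) : 0 < 1 + x ^+ 2.
Proof. by rewrite ltr_pwDl ?ltr01 ?sqr_ge0. Qed.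

Lemma onesq_neq0 (R : realDomainType) (x : R) : 1 + x ^+ 2 != 0.
Proof. by rewrite gt_eqF // onesq_gt0. Qed.

(** The coefficient with which the two transposed entries in positions (a, b)
and (b, a) of a tangent vector are coupled in the Hessian of u, when l and m are
the a-th and b-th singular values of Z. *)
Definition cross (R : realFieldType) (l m : R) : R :=
  l * m * ((1 + l ^+ 2)^-1 + (1 + m ^+ 2)^-1).

Lemma cross_sym (R : realFieldType) (l m : R) : cross l m = cross m l.
Proof. by rewrite /cross (mulrC l) [X in _ * X]addrC. Qed.

Lemma cross_ge0 (R : realFieldType) (l m : R) :
  0 <= l -> 0 <= m -> 0 <= cross l m.
Proof.
move=> l0 m0; rewrite !mulr_ge0 ?addr_ge0 // invr_ge0 ltW //; exact: onesq_gt0.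
Qed.

Lemma one_sub_cross (R : realFieldType) (l m : R) :
  1 - cross l m = (1 - l * m) * (1 - l * m + l ^+ 2 + m ^+ 2) /
                  ((1 + l ^+ 2) * (1 + m ^+ 2)).
Proof.
have l1 := lt0r_neq0 (onesq_gt0 l); have m1 := lt0r_neq0 (onesq_gt0 m).
by rewrite /cross; field; rewrite m1 l1.
Qed.

Lemma cross_le1 (R : realFieldType) (l m : R) :
  0 <= l -> 0 <= m -> l * m <= 1 -> cross l m <= 1.
Proof.
move=> l0 m0 lm; rewrite -subr_ge0 one_sub_cross.
have h : 0 <= 1 - l * m + l ^+ 2 + m ^+ 2 by have := sqr_ge0 (l - m); nra.
by rewrite divr_ge0 // mulr_ge0 ?subr_ge0 // ltW // onesq_gt0.
Qed.

(** With q = l m and S = l^2 + m^2 the numerator of 1 - cross l m is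
(1 - q)(1 - q + S), which is at least 1 - q^2 >= 1 - S^2/4 because 2 q <= S. *)
Lemma cross_bound (R : realFieldType) (l m u : R) :
  0 <= l -> 0 <= m -> l ^+ 2 + m ^+ 2 <= u -> u <= 2 ->
  (2 - 2^-1 * u ^+ 2) / ((1 + l ^+ 2) * (1 + m ^+ 2)) <= 2 - 2 * cross l m.
Proof.
move=> l0 m0 lmu u2.
have -> : 2 - 2 * cross l m = 2 * (1 - cross l m) by ring.
rewrite one_sub_cross mulrA ler_pM2r ?invr_gt0 ?mulr_gt0 ?onesq_gt0 //.
have := sqr_ge0 (l - m); have := mulr_ge0 l0 m0.
set q := l * m => q0; rewrite sqrrB -/q mulr2n => h.
have qu : 2 * q <= u by lra.
have h1 : 0 <= (1 - q) * (l ^+ 2 + m ^+ 2 - 2 * q) by rewrite mulr_ge0 //; lra.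
have h2 : 0 <= (u - 2 * q) * (u + 2 * q) by rewrite mulr_ge0 //; lra.
nra.
Qed.

(** When k = u^2 / 2 and t = l^2 is a squared singular value, [phi k t] is
l^2 / d, where d is the coefficient of the square of the corresponding diagonal
entry in Hess u - (2 - u^2/2) g. *)
Definition phi (R : realFieldType) (k t : R) : R :=
  t * (1 + t) ^+ 2 / (6 * t ^+ 2 + 8 * t + k).

(** The derivative of [phi k] at s. *)
Definition dphi (R : realFieldType) (k s : R) : R :=
  ((1 + s) * (1 + 3 * s) * (6 * s ^+ 2 + 8 * s + k)
    - s * (1 + s) ^+ 2 * (12 * s + 8)) / (6 * s ^+ 2 + 8 * s + k) ^+ 2.

(** The expression below is the cofactor of (t - s)^2 in the numerator of the
difference between the tangent of [phi k] at s and [phi k] at t. It is where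
u <= 2 is needed for concavity. *)
Lemma phi_remainder_ge0 (R : realFieldType) (u s t : R) (k := 2^-1 * u ^+ 2)
    (a := 2 - 3 * k) :
  0 <= u <= 2 -> 0 <= s <= u -> 0 <= t <= u ->
  0 <= 6 * (a * s - 2 * k) * (6 * s ^+ 2 + 8 * s + k) +
    (- 6 * a * s ^+ 2 + a * k + 24 * k * s + 16 * k) * (6 * t + 6 * s + 8).
Proof.
move=> /andP[u0 u2] /andP[s0 su] /andP[t0 tu].
have k0 : 0 <= k by rewrite /k; nra.
have k2 : k <= 2 by rewrite /k; nra.
have -> : 6 * (a * s - 2 * k) * (6 * s ^+ 2 + 8 * s + k) +
    (- 6 * a * s ^+ 2 + a * k + 24 * k * s + 16 * k) * (6 * t + 6 * s + 8) =
  k * (144 - 36 * k + 12 * a * s + 72 * s ^+ 2 + 192 * s) +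
  6 * t * (k * (a + 16 + 24 * s)) - 36 * a * t * s ^+ 2 by rewrite /a; ring.
(* As t s^2 <= u^2 s, this controls the last term, negative when a > 0. *)
have ts : t * s ^+ 2 <= 2 * k * s.
  rewrite (_ : 2 * k = u * u); last by rewrite /k; field.
  rewrite expr2 mulrA ler_wpM2r //.
  by rewrite ler_pM.
have ts0 : 0 <= t * s ^+ 2 by rewrite mulr_ge0 ?sqr_ge0.
have kt : 0 <= 6 * t * (k * (a + 16 + 24 * s)).
  by rewrite !mulr_ge0 //; rewrite /a; lra.
have ks := mulr_ge0 k0 s0.
have kss := mulr_ge0 k0 (sqr_ge0 s).
have kk : 0 <= k * (144 - 36 * k) by rewrite mulr_ge0 //; lra.
suff : 0 <= k * s * (192 + 12 * a) - 36 * a * (t * s ^+ 2) by nra.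
have [a0|a0] := lerP 0 a.
  have : a * (t * s ^+ 2) <= a * (2 * k * s) by rewrite ler_wpM2l.
  have : 0 <= k * s * (192 - 60 * a) by rewrite mulr_ge0 // /a; lra.
  by lra.
have : 0 <= k * s * (192 + 12 * a) by rewrite mulr_ge0 // /a; lra.
have : 0 <= - a * (t * s ^+ 2) by rewrite mulr_ge0 // oppr_ge0 ltW.
by lra.
Qed.

(** On [0, u] the graph of [phi k] lies below its tangents: [phi k] is concave
there. *)
Lemma phi_tangent (R : realFieldType) (u s t : R) (k := 2^-1 * u ^+ 2) :
  0 < u <= 2 -> 0 <= s <= u -> 0 <= t <= u ->
  phi k t <= phi k s + dphi k s * (t - s).
Proof.
move=> /andP[u0 u2] sb tb.
have k0 : 0 < k by rewrite /k mulr_gt0 ?exprn_gt0 ?invr_gt0.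
have Q0 x : 0 <= x <= u -> 0 < 6 * x ^+ 2 + 8 * x + k.
  by move=> /andP[x0 xu]; rewrite ltr_wpDl // addr_ge0 // mulr_ge0 // sqr_ge0.
have Qs := Q0 _ sb; have Qt := Q0 _ tb.
rewrite -subr_ge0.
have -> : phi k s + dphi k s * (t - s) - phi k t =
  (t - s) ^+ 2 * (6 * ((2 - 3 * k) * s - 2 * k) * (6 * s ^+ 2 + 8 * s + k) +
    (- 6 * (2 - 3 * k) * s ^+ 2 + (2 - 3 * k) * k + 24 * k * s + 16 * k)
      * (6 * t + 6 * s + 8)) /
  (18 * (6 * t ^+ 2 + 8 * t + k) * (6 * s ^+ 2 + 8 * s + k) ^+ 2).
  rewrite /phi /dphi; move: (lt0r_neq0 Qs) (lt0r_neq0 Qt).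
  clearbody k => h1 h2.
  by field; rewrite h1 h2.
have u0' : 0 <= u <= 2 by rewrite (ltW u0).
have := phi_remainder_ge0 u0' sb tb; cbv zeta; rewrite -/k => rem.
by rewrite divr_ge0 // mulr_ge0 ?sqr_ge0 // mulr_ge0 // ltW.
Qed.

(** Cauchy-Schwarz for the weights d, in the form in which it bounds a rank-one
form C L^2, L = Sum l_i x_i, by a diagonal form: expand the nonnegative sum of
the d_i (x_i - C L l_i / d_i)^2. *)
Lemma weighted_cauchy_schwarz (R : realFieldType) (p : nat)
    (d l x : 'I_p -> R) (C : R) :
  (forall i, 0 < d i) -> C * (\sum_i l i ^+ 2 / d i) <= 1 -> 0 <= C ->
  C * (\sum_i l i * x i) ^+ 2 <= \sum_i d i * x i ^+ 2.
Proof.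
move=> d0 CM C0; set L := \sum_i l i * x i; set M := \sum_i _ in CM.
have : 0 <= \sum_i d i * (x i - C * L * l i / d i) ^+ 2.
  by apply: sumr_ge0 => i _; rewrite mulr_ge0 ?sqr_ge0 ?ltW.
have -> : \sum_i d i * (x i - C * L * l i / d i) ^+ 2 =
    \sum_i d i * x i ^+ 2 - (2 * C * L) * L + (C * L) ^+ 2 * M.
  have -> : 2 * C * L * L = \sum_i 2 * C * L * (l i * x i) by rewrite -mulr_sumr.
  have -> : (C * L) ^+ 2 * M = \sum_i (C * L) ^+ 2 * (l i ^+ 2 / d i).
    by rewrite -mulr_sumr.
  rewrite -sumrB -big_split /=; clearbody L.
  by apply: eq_bigr => i _; have := lt0r_neq0 (d0 i) => di; field.
have : C * L ^+ 2 * (C * M) <= C * L ^+ 2.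
  by rewrite ler_piMr // mulr_ge0 ?sqr_ge0.
nra.
Qed.

(** The inequality for the diagonal entries x i, with l i the singular values:
it follows from Cauchy-Schwarz and from Jensen's inequality for [phi], and is an
equality when all the l i coincide and all the x i coincide. *)
Lemma diag_bound (R : realFieldType) (p : nat) (l x : 'I_p -> R)
    (u := \sum_i l i ^+ 2) : (0 < p)%N -> u <= 2 ->
  \sum_i (2 - 2^-1 * u ^+ 2) * (x i ^+ 2 / (1 + l i ^+ 2) ^+ 2)
  + ((3 + 4^-1 * p%:R ^+ 2) * u + 4 * p%:R) / (2 * (u + p%:R) ^+ 2) *
    (2 * \sum_i l i * x i) ^+ 2
  <= \sum_i (2 + 2 * cross (l i) (l i)) * x i ^+ 2.
Proof.
move=> p0 u2.
have u0 : 0 <= u by apply: sumr_ge0 => i _; exact: sqr_ge0.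
have lu i : l i ^+ 2 <= u.
  by rewrite /u (bigD1 i) //= lerDl sumr_ge0 // => j _; rewrite sqr_ge0.
have hcross i : 2 + 2 * cross (l i) (l i) = (2 + 6 * l i ^+ 2) / (1 + l i ^+ 2).
  by have := lt0r_neq0 (onesq_gt0 (l i)); rewrite /cross => h; field.
(* For u = 0 every singular value vanishes and the weights d below would be 0. *)
have [ueq0|une0] := eqVneq u 0.
  have l0 i : l i = 0.
    by apply/eqP; rewrite -sqrf_eq0 eq_le sqr_ge0 -[X in _ <= X]ueq0 lu.
  rewrite [X in _ * (2 * X) ^+ 2]big1 => [|i _]; last by rewrite l0 mul0r.
  rewrite mulr0 expr0n mulr0 addr0 ueq0 ler_sum // => i _.
  by rewrite hcross l0 !expr0n /= !mulr0 !addr0 expr1n !divr1 subr0.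
have ugt0 : 0 < u by rewrite lt_neqAle eq_sym une0.
pose k := 2^-1 * u ^+ 2.
pose d i := (6 * (l i ^+ 2) ^+ 2 + 8 * l i ^+ 2 + k) / (1 + l i ^+ 2) ^+ 2.
have k0 : 0 < k by rewrite /k mulr_gt0 ?exprn_gt0 ?invr_gt0.
have Q0 i : 0 < 6 * (l i ^+ 2) ^+ 2 + 8 * l i ^+ 2 + k.
  by rewrite ltr_wpDl // addr_ge0 // mulr_ge0 // sqr_ge0.
have d0 i : 0 < d i.
  by rewrite /d divr_gt0 // exprn_gt0 // onesq_gt0.
have pR : 0 < p%:R :> R by rewrite ltr0n.
set D := _ / (2 * _).
have D0 : 0 <= D.
  rewrite /D divr_ge0 //; last by rewrite mulr_ge0 ?sqr_ge0.
  by have := mulr_ge0 u0 (sqr_ge0 (p%:R : R)); lra.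
have sb : 0 <= u / p%:R <= u.
  by rewrite divr_ge0 //= ler_pdivrMr // ler_peMr // ler1n.
have jensen : 4 * D * (\sum_i l i ^+ 2 / d i) <= 1.
  have -> : \sum_i l i ^+ 2 / d i = \sum_i phi k (l i ^+ 2).
    apply: eq_bigr => i _; rewrite /d /phi.
    have h1 := lt0r_neq0 (onesq_gt0 (l i)); have h2 := lt0r_neq0 (Q0 i).
    by field; rewrite h1 andbT (exprM (l i) 2 2).
  (* Jensen: sum the tangent inequalities at the mean u / p. *)
  have le : \sum_i phi k (l i ^+ 2) <= p%:R * phi k (u / p%:R).
    apply: (@le_trans _ _ (\sum_i (phi k (u / p%:R) +
                 dphi k (u / p%:R) * (l i ^+ 2 - u / p%:R)))).
      apply: ler_sum => i _; apply: phi_tangent => //.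
      - by rewrite ugt0 u2.
      - by rewrite sqr_ge0 lu.
    rewrite big_split /= -[X in _ + X]mulr_sumr sumrB -/u !sumr_const !card_ord.
    have -> : u / p%:R *+ p = u by rewrite -mulr_natr divfK ?gt_eqF.
    by rewrite subrr mulr0 addr0 mulr_natl.
  apply: (@le_trans _ _ (4 * D * (p%:R * phi k (u / p%:R)))).
    by rewrite ler_wpM2l // mulr_ge0.
  rewrite /D /phi /k.
  have h1 := lt0r_neq0 pR.
  have h2 : u + p%:R != 0 by rewrite lt0r_neq0 // addr_gt0.
  have h3 : 12 * u + 16 * p%:R + p%:R ^+ 2 * u != 0.
    rewrite lt0r_neq0 // ltr_wpDr ?mulr_ge0 ?sqr_ge0 //.
    by rewrite ltr_wpDl ?mulr_ge0 // mulr_gt0.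
  rewrite le_eqVlt; apply/orP; left; apply/eqP.
  clear -h1 h2 h3 ugt0; clearbody u.
  have h4 := lt0r_neq0 ugt0.
  field; rewrite h1 h2 andbT /=.
  rewrite (_ : _ + _ = u * (12 * u + 16 * p%:R + p%:R ^+ 2 * u)); last by ring.
  by rewrite mulf_neq0.
have cs := weighted_cauchy_schwarz x d0 jensen (mulr_ge0 (ler0n _ 4) D0).
rewrite (_ : D * _ = 4 * D * (\sum_i l i * x i) ^+ 2); last first.
  by move: (\sum_i _) => L; clear; clearbody D; ring.
rewrite -lerBrDl -sumrB (le_trans cs) //.
rewrite le_eqVlt; apply/orP; left; apply/eqP.
apply: eq_bigr => i _; rewrite hcross /d /k.
have h1 := lt0r_neq0 (onesq_gt0 (l i)).
by field.
Qed.

(** * Singular value decomposition *)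

(** A nonzero real symmetric matrix has a nonzero real eigenvalue: over the
complex numbers it is unitarily diagonalizable with real eigenvalues, not all
zero, and a real root of the characteristic polynomial has a real eigenvector. *)
Lemma symmetric_eigenvector (R : rcfType) (n : nat) (S : 'M[R]_n) :
  S^T = S -> S != 0 ->
  exists (d : R) (v : 'rV[R]_n), [/\ d != 0, v != 0 & v *m S = d *: v].
Proof.
move=> symS S0; pose Sc := map_mx (real_complex R) S.
have hS : Sc \is hermsymmx.
  apply/is_hermitianmxP; rewrite expr0 scale1r; apply/matrixP => i j.
  have sij : S j i = S i j by rewrite -[in LHS]symS mxE.
  by rewrite !mxE /= sij; apply/esym/conjc_real.
have /orthomx_spectralP Seq := hermitian_normalmx hS.
have /mxOverP spR := hermitian_spectral_diag_real hS.
set P := spectralmx Sc in Seq; set sp := spectral_diag Sc in Seq spR.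
have Pu : P \in unitmx := spectral_unit Sc.
have /rV0Pn[j spj] : sp != 0.
  apply: contraNneq S0 => sp0.
  rewrite -(map_mx_eq0 (real_complex R)) -/Sc Seq sp0.
  have -> : diag_mx 0 = 0 :> 'M[complex R]_n.
    by apply/matrixP => a b; rewrite !mxE mul0rn.
  by rewrite mulmx0 mul0mx.
have [d spd] : exists d, sp 0 j = real_complex R d.
  exact/complex_realP/spR.
exists d.
have d0 : d != 0 by move: spj; rewrite spd; apply: contraNneq => ->.
have : eigenvalue Sc (sp 0 j).
  apply/eigenvalueP; exists (row j P).
    rewrite -row_mul Seq !mulmxA mulmxV // mul1mx row_mul.
    by rewrite row_diag_mx -scalemxAl -rowE.
  apply: contraTneq Pu => rj0; rewrite -row_free_unit.
  apply: contraTN (oner_neq0 (complex R)) => /row_freeP[Q PQ].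
  have := congr1 (fun M => row j M) PQ.
  rewrite row_mul rj0 mul0mx => /rowP/(_ j); rewrite !mxE eqxx => /eqP.
  by rewrite eq_sym oner_eq0.
rewrite eigenvalue_root_char spd -map_char_poly fmorph_root.
by rewrite -eigenvalue_root_char => /eigenvalueP[v vS v0]; exists v.
Qed.

Lemma rV_gram_ge0 (R : realDomainType) (n : nat) (v : 'rV[R]_n) :
  0 <= (v *m v^T) 0 0.
Proof. by rewrite mxE sumr_ge0 // => i _; rewrite mxE -expr2 sqr_ge0. Qed.

Lemma rV_gram_eq0 (R : realDomainType) (n : nat) (v : 'rV[R]_n) :
  ((v *m v^T) 0 0 == 0) = (v == 0).
Proof.
apply/eqP/eqP => [|->]; last by rewrite mul0mx mxE.
rewrite mxE => /psumr_eq0P v0; apply/rowP => i; rewrite !mxE.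
have := v0 _ i isT; rewrite mxE -expr2 => /(_ _)/eqP; rewrite sqrf_eq0 => h.
by apply/eqP/h => j _; rewrite mxE -expr2 sqr_ge0.
Qed.

Lemma gram_mx_eq0 (R : realDomainType) (n m : nat) (Z : 'M[R]_(n, m)) :
  (Z *m Z^T == 0) = (Z == 0).
Proof.
apply/eqP/eqP => [ZZ|->]; last by rewrite mul0mx.
apply/row_matrixP => i; rewrite row0; apply/eqP; rewrite -rV_gram_eq0.
have := congr1 (fun M : 'M[R]_n => M i i) ZZ; rewrite !mxE => h.
by rewrite -[X in _ == X]h; apply/eqP/eq_bigr => j _; rewrite !mxE.
Qed.

Lemma trmxZ (R : pzRingType) (n m : nat) (a : R) (Z : 'M[R]_(n, m)) :
  (a *: Z)^T = a *: Z^T.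
Proof. by apply/matrixP => i j; rewrite !mxE. Qed.

Lemma trmxB (R : pzRingType) (n m : nat) (Y Z : 'M[R]_(n, m)) :
  (Y - Z)^T = Y^T - Z^T.
Proof. by apply/matrixP => i j; rewrite !mxE. Qed.

(** A nonzero matrix has a pair of unit singular vectors for some positive
singular value; a is an eigenvector of Z Z^T and b is proportional to a Z. *)
Lemma singular_pair (R : rcfType) (n m : nat) (Z : 'M[R]_(n, m)) : Z != 0 ->
  exists (s : R) (a : 'rV[R]_n) (b : 'rV[R]_m),
    [/\ 0 < s, a *m a^T = 1%:M, b *m b^T = 1%:M,
        a *m Z = s *: b & b *m Z^T = s *: a].
Proof.
move=> Z0; have symS : (Z *m Z^T)^T = Z *m Z^T by rewrite trmx_mul trmxK.
have S0 : Z *m Z^T != 0 by rewrite gram_mx_eq0.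
have [d [v [d0 v0 vS]]] := symmetric_eigenvector symS S0.
set c := (v *m v^T) 0 0.
have c0 : 0 < c by rewrite lt_neqAle rV_gram_ge0 eq_sym rV_gram_eq0 v0.
have dc : ((v *m Z) *m (v *m Z)^T) 0 0 = d * c.
  by rewrite trmx_mul mulmxA -(mulmxA v) vS -scalemxAl mxE.
have d1 : 0 < d.
  have : 0 <= d * c by rewrite -dc rV_gram_ge0.
  by rewrite pmulr_lge0 // lt_neqAle eq_sym d0.
pose s := Num.sqrt d; have s0 : 0 < s by rewrite sqrtr_gt0.
have sd : s ^+ 2 = d by rewrite sqr_sqrtr // ltW.
pose r := (Num.sqrt c)^-1.
have rc : r ^+ 2 * c = 1.
  by rewrite /r exprVn sqr_sqrtr ?mulVf ?gt_eqF // ltW.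
exists s, (r *: v), (s^-1 *: ((r *: v) *m Z)); split=> //.
- rewrite trmxZ -scalemxAl -scalemxAr scalerA -expr2.
  by rewrite [v *m _]mx11_scalar -/c scale_scalar_mx rc.
- rewrite -!scalemxAl !trmxZ -!scalemxAr !scalerA.
  rewrite [v *m Z *m _]mx11_scalar dc scale_scalar_mx -sd; congr (_%:M).
  have s1 := lt0r_neq0 s0.
  by rewrite -[RHS]rc; field.
- by rewrite scalerA divff ?gt_eqF // scale1r.
- rewrite -!scalemxAl -mulmxA vS !scalerA; congr (_ *: _).
  have s1 := lt0r_neq0 s0.
  by rewrite -sd; field.
Qed.

(** Every unit row vector is the first row of an orthogonal matrix, namely of the
Householder reflection exchanging it with the first basis vector if the two
differ. *)
Lemma orthogonal_row0 (R : realFieldType) (n : nat) (v : 'rV[R]_n.+1) :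
  v *m v^T = 1%:M ->
  exists H : 'M[R]_n.+1, H *m H^T = 1%:M /\ delta_mx 0 0 *m H = v.
Proof.
move=> vv; pose e : 'rV[R]_n.+1 := delta_mx 0 0.
have ee : e *m e^T = 1%:M.
  rewrite trmx_delta mul_delta_mx; apply/matrixP => i j.
  by rewrite !ord1 !mxE eqxx.
have [->|ve] := eqVneq v e.
  by exists 1%:M; rewrite trmx1 !mulmx1.
pose w := v - e; pose c : R := (w *m w^T) 0 0.
have c0 : c != 0 by rewrite /c rV_gram_eq0 subr_eq0.
have wT : w *m w^T = c%:M by rewrite [LHS]mx11_scalar.
have ew : e *m w^T = (- (c / 2))%:M.
  rewrite [LHS]mx11_scalar; congr (_%:M).
  have veT : v *m e^T = e *m v^T.
    rewrite -[LHS]trmxK trmx_mul trmxK [RHS]mx11_scalar.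
    by rewrite [in LHS](mx11_scalar (e *m v^T)) tr_scalar_mx.
  rewrite /c /w trmxB !mulmxBr !mulmxBl vv ee veT.
  rewrite !mxE eqxx !mulr1n; set t := \sum_i _; by field.
have hw : e + w = v by rewrite /w addrC subrK.
clearbody c; clearbody w.
exists (1%:M - (2 / c) *: (w^T *m w)); split.
  rewrite trmxB trmxZ trmx_mul trmxK trmx1.
  rewrite mulmxBl mul1mx mulmxBr mulmx1 -scalemxAl -scalemxAr scalerA.
  rewrite mulmxA -(mulmxA w^T) wT mul_mx_scalar -scalemxAl scalerA.
  have -> : 2 / c * (2 / c) * c = 2 / c + 2 / c by field.
  by rewrite scalerDl opprB addrK subrK.
rewrite mulmxBr mulmx1 -scalemxAr mulmxA ew mul_scalar_mx scalerA.
rewrite (_ : 2 / c * _ = -1); last by field.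
by rewrite scaleN1r opprK.
Qed.

(** The rectangular diagonal matrix with entries s 0, s 1, ...; the indices are
natural numbers, so that the same sequence s may be used in every shape. *)
Definition rect_diag_mx (R : pzRingType) (n m : nat) (s : nat -> R) :
  'M[R]_(n, m) := \matrix_(i, j) (s i *+ (i == j :> nat)).

(** By induction on the size: rotating a pair of singular vectors to the first
basis vectors makes Z block diagonal. *)
Lemma svd (R : rcfType) (n m : nat) (Z : 'M[R]_(n, m)) :
  exists (V : 'M[R]_n) (W : 'M[R]_m) (s : nat -> R),
    [/\ V *m V^T = 1%:M, W *m W^T = 1%:M, forall i, 0 <= s i
      & Z = V *m rect_diag_mx n m s *m W^T].
Proof.
elim: n => [|n IHn] in m Z *.
  exists 1%:M, 1%:M, (fun=> 0); split; rewrite ?trmx1 ?mulmx1 //.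
  by apply/matrixP => -[].
case: m Z => [|m] Z.
  exists 1%:M, 1%:M, (fun=> 0); split; rewrite ?trmx1 ?mulmx1 //.
  by apply/matrixP => i -[].
have [->|Z0] := eqVneq Z 0.
  exists 1%:M, 1%:M, (fun=> 0); split; rewrite ?trmx1 ?mulmx1 //.
  by rewrite mul1mx; apply/matrixP => i j; rewrite !mxE mul0rn.
have [d [a [b [d0 aa bb aZ bZ]]]] := singular_pair Z0.
have [V0 [V0o V0a]] := orthogonal_row0 aa.
have [W0 [W0o W0b]] := orthogonal_row0 bb.
have V0o' := mulmx1C V0o; have W0o' := mulmx1C W0o.
pose Y : 'M[R]_(1 + n, 1 + m) := V0 *m Z *m W0^T.
have [V1 [W1 [s [V1o W1o s0 Y1]]]] := IHn m (drsubmx Y).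
(* The first row and the first column of Y vanish off the diagonal. *)
have r0 : row 0 Y = d *: delta_mx 0 0.
  by rewrite rowE /Y !mulmxA V0a aZ -scalemxAl -W0b -mulmxA W0o mulmx1.
have c0 : col 0 Y = d *: delta_mx 0 0.
  rewrite colE /Y -[RHS]trmxK -[LHS]trmxK; congr (_^T).
  rewrite !trmx_mul trmxZ !trmx_delta !trmxK mulmxA W0b mulmxA bZ.
  by rewrite -scalemxAl -V0a -mulmxA V0o mulmx1.
have ZY : Z = V0^T *m Y *m W0.
  by rewrite /Y !mulmxA V0o' mul1mx -mulmxA W0o' mulmx1.
clearbody Y.
have Yblock : Y = block_mx d%:M 0 0 (V1 *m rect_diag_mx n m s *m W1^T).
  rewrite -Y1 -[LHS]submxK; congr block_mx.
  - apply/matrixP => i j; rewrite !ord1 !mxE.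
    have := congr1 (fun M : 'rV[R]_(1 + m) => M 0 0) r0; rewrite !mxE /= mulr1.
    by move=> <-; congr (Y _ _); apply/val_inj.
  - apply/matrixP => i j; rewrite !ord1 !mxE.
    have := congr1 (fun M : 'rV[R]_(1 + m) => M 0 (rshift 1 j)) r0.
    rewrite !mxE /= mulr0.
    by move=> <-; congr (Y _ _); apply/val_inj.
  - apply/matrixP => i j; rewrite !ord1 !mxE.
    have := congr1 (fun M : 'cV[R]_(1 + n) => M (rshift 1 i) 0) c0.
    rewrite !mxE /= mulr0.
    by move=> <-; congr (Y _ _); apply/val_inj.
have blockT (k : nat) (M : 'M[R]_k) : M *m M^T = 1%:M ->
    block_mx (1%:M : 'M[R]_1) 0 0 M *m (block_mx (1%:M : 'M[R]_1) 0 0 M)^T = 1%:M.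
  move=> Mo; rewrite tr_block_mx !trmx0 trmx1 mulmx_block Mo.
  by rewrite !mulmx0 !mul0mx mulmx1 !addr0 add0r -scalar_mx_block.
pose V : 'M[R]_(1 + n) := V0^T *m block_mx (1%:M : 'M[R]_1) 0 0 V1.
pose W : 'M[R]_(1 + m) := W0^T *m block_mx (1%:M : 'M[R]_1) 0 0 W1.
pose t i := if i is j.+1 then s j else d.
have Dblock : rect_diag_mx (1 + n) (1 + m) t =
    block_mx (d%:M : 'M[R]_1) 0 0 (rect_diag_mx n m s).
  apply/matrixP => i j; rewrite !mxE.
  case: splitP => i' Ei; rewrite !mxE; case: splitP => j' Ej; rewrite !mxE.
  - by rewrite Ei Ej !ord1.
  - by rewrite Ei Ej !ord1.
  - by rewrite Ei Ej !ord1.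
  - by rewrite Ei Ej.
have Yfact : Y = block_mx (1%:M : 'M[R]_1) 0 0 V1 *m
    rect_diag_mx (1 + n) (1 + m) t *m (block_mx (1%:M : 'M[R]_1) 0 0 W1)^T.
  rewrite Yblock Dblock tr_block_mx !trmx0 trmx1 !mulmx_block.
  by rewrite !mulmx0 !mul0mx !mulmx1 !mul1mx !addr0 !add0r !mul0mx.
have ZVW : Z = V *m rect_diag_mx (1 + n) (1 + m) t *m W^T.
  by rewrite ZY Yfact /V /W trmx_mul trmxK !mulmxA.
exists V, W, t; split=> //.
- by rewrite /V trmx_mul trmxK mulmxA -(mulmxA V0^T) blockT // mulmx1.
- by rewrite /W trmx_mul trmxK mulmxA -(mulmxA W0^T) blockT // mulmx1.
- by case=> [|i]; [exact: ltW d0 | exact: s0].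
Qed.

(** Z = V diag(s) W^T is a singular value decomposition. The sequence s is total,
and extended by 0 beyond the min(n, m) singular values. *)
Definition is_svd (R : realDomainType) (n m : nat) (Z : 'M[R]_(n, m))
    (V : 'M[R]_n) (W : 'M[R]_m) (s : nat -> R) : Prop :=
  [/\ V *m V^T = 1%:M, W *m W^T = 1%:M, forall i, 0 <= s i,
      forall i, (minn n m <= i)%N -> s i = 0
    & Z = V *m rect_diag_mx n m s *m W^T].

Lemma svd_exists (R : rcfType) (n m : nat) (Z : 'M[R]_(n, m)) :
  exists V W s, is_svd Z V W s.
Proof.
have [V [W [s [Vo Wo s0 ZE]]]] := svd Z.
exists V, W, (fun i => if (i < minn n m)%N then s i else 0); split=> //.
- by move=> i; case: ifP.
- by move=> i; rewrite leqNgt => /negPf->.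
rewrite {1}ZE; congr (_ *m _ *m _); apply/matrixP => i j; rewrite !mxE.
have [ij|] := eqVneq (i : nat) j; last by rewrite !mulr0n.
by rewrite leq_min ltn_ord /= ij ltn_ord.
Qed.

Lemma tr_rect_diag_mx (R : pzRingType) (n m : nat) (s : nat -> R) :
  (rect_diag_mx n m s)^T = rect_diag_mx m n s.
Proof.
by apply/matrixP => i j; rewrite !mxE eq_sym; case: eqVneq => [->|].
Qed.

Lemma is_svd_tr (R : realDomainType) (n m : nat) (Z : 'M[R]_(n, m)) V W s :
  is_svd Z V W s -> is_svd Z^T W V s.
Proof.
case=> Vo Wo s0 sp ZE; split=> //; first by rewrite minnC.
by rewrite ZE !trmx_mul trmxK tr_rect_diag_mx mulmxA.
Qed.

Lemma mul_rect_diag_mx (R : pzRingType) (n m k : nat) (s t : nat -> R) :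
  (forall i, (m <= i < n)%N -> s i * t i = 0) ->
  rect_diag_mx n m s *m rect_diag_mx m k t =
  rect_diag_mx n k (fun i => s i * t i).
Proof.
move=> st0; apply/matrixP => i j; rewrite !mxE.
have [im|mi] := ltnP i m; last first.
  rewrite st0 ?mi ?ltn_ord // mul0rn big1 // => l _; rewrite !mxE.
  case: eqVneq => [il|_]; last by rewrite mulr0n mul0r.
  by have := ltn_ord l; rewrite -il ltnNge mi.
rewrite (bigD1 (Ordinal im)) //= big1 => [|l lneq].
  by rewrite !mxE /= eqxx mulr1n addr0 mulrnAr.
rewrite !mxE; case: eqVneq => [il|_]; last by rewrite mulr0n mul0r.
by case/eqP: lneq; apply/val_inj.
Qed.

Lemma rect_diag_mulE (R : pzRingType) (n m : nat) (s : nat -> R)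
    (Y : 'M[R]_(n, m)) i j : (rect_diag_mx n n s *m Y) i j = s i * Y i j.
Proof.
rewrite mxE (bigD1 i) //= big1 => [|l li]; rewrite !mxE.
  by rewrite eqxx mulr1n addr0.
by rewrite val_eqE eq_sym (negPf li) mulr0n mul0r.
Qed.

Lemma mul_rect_diagE (R : pzRingType) (n m : nat) (s : nat -> R)
    (Y : 'M[R]_(n, m)) i j : (Y *m rect_diag_mx m m s) i j = Y i j * s j.
Proof.
rewrite mxE (bigD1 j) //= big1 => [|l li]; rewrite !mxE.
  by rewrite eqxx mulr1n addr0.
by rewrite val_eqE (negPf li) mulr0n mulr0.
Qed.

Lemma rect_diag_mx1 (R : pzRingType) (n : nat) :
  rect_diag_mx n n (fun=> 1 : R) = 1%:M.
Proof. by apply/matrixP => i j; rewrite !mxE. Qed.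

Lemma svd_gram (R : realDomainType) (n m : nat) (Z : 'M[R]_(n, m)) V W s :
  is_svd Z V W s -> Z *m Z^T = V *m rect_diag_mx n n (fun i => s i ^+ 2) *m V^T.
Proof.
case=> Vo Wo _ sp ->; rewrite !trmx_mul trmxK !mulmxA -(mulmxA _ W^T).
rewrite (mulmx1C Wo) mulmx1 -(mulmxA V) tr_rect_diag_mx mul_rect_diag_mx //.
by move=> i /andP[mi _]; rewrite sp ?mul0r // geq_min mi orbT.
Qed.

Lemma svd_gram1 (R : realDomainType) (n m : nat) (Z : 'M[R]_(n, m)) V W s :
  is_svd Z V W s -> 1%:M + Z *m Z^T =
    V *m rect_diag_mx n n (fun i => 1 + s i ^+ 2) *m V^T.
Proof.
move=> Zsvd; have [Vo _ _ _ _] := Zsvd; rewrite (svd_gram Zsvd).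
have -> : rect_diag_mx n n (fun i => 1 + s i ^+ 2) =
    1%:M + rect_diag_mx n n (fun i => s i ^+ 2).
  by apply/matrixP => i j; rewrite !mxE -mulrnDl.
by rewrite mulmxDr mulmxDl mulmx1 Vo.
Qed.

Lemma orthogonal_conj_mul (R : comPzRingType) (n : nat) (V A B : 'M[R]_n) :
  V *m V^T = 1%:M ->
  (V *m A *m V^T) *m (V *m B *m V^T) = V *m (A *m B) *m V^T.
Proof.
by move=> Vo; rewrite !mulmxA -(mulmxA _ V^T V) (mulmx1C Vo) mulmx1.
Qed.

Lemma mul_rect_diag_sq (R : pzRingType) (n : nat) (s t : nat -> R) :
  rect_diag_mx n n s *m rect_diag_mx n n t =
  rect_diag_mx n n (fun i => s i * t i).
Proof.
by apply: mul_rect_diag_mx => i /andP[ni /leq_trans/(_ ni)]; rewrite ltnn.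
Qed.

Lemma svd_gram1V (R : realFieldType) (n m : nat) (Z : 'M[R]_(n, m)) V W s :
  is_svd Z V W s ->
  (1%:M + Z *m Z^T) *m
    (V *m rect_diag_mx n n (fun i => (1 + s i ^+ 2)^-1) *m V^T) = 1%:M.
Proof.
move=> Zsvd; have [Vo _ _ _ _] := Zsvd.
rewrite (svd_gram1 Zsvd) orthogonal_conj_mul // mul_rect_diag_sq.
have -> : rect_diag_mx n n (fun i => (1 + s i ^+ 2) / (1 + s i ^+ 2)) =
    rect_diag_mx n n (fun=> 1).
  by apply/matrixP => i j; rewrite !mxE divff ?onesq_neq0.
by rewrite rect_diag_mx1 mulmx1.
Qed.

Lemma gram1_unit (R : rcfType) (n m : nat) (Z : 'M[R]_(n, m)) :
  1%:M + Z *m Z^T \in unitmx.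
Proof.
have [V [W [s Zsvd]]] := svd_exists Z.
exact: (mulmx1_unit (svd_gram1V Zsvd)).1.
Qed.

Lemma svd_invmx_gram1 (R : rcfType) (n m : nat) (Z : 'M[R]_(n, m)) V W s :
  is_svd Z V W s -> invmx (1%:M + Z *m Z^T) =
    V *m rect_diag_mx n n (fun i => (1 + s i ^+ 2)^-1) *m V^T.
Proof.
move=> Zsvd; rewrite -[RHS](mulKmx (gram1_unit Z)) (svd_gram1V Zsvd).
by rewrite mulmx1.
Qed.

Lemma rect_diag_mx_trig (R : pzRingType) (n : nat) (s : nat -> R) :
  is_trig_mx (rect_diag_mx n n s).
Proof. by apply/is_trig_mxP => i j ij; rewrite mxE ltn_eqF. Qed.

Lemma char_poly_orthogonal_conj (R : comNzRingType) (n : nat) (V A : 'M[R]_n) :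
  V *m V^T = 1%:M -> char_poly (V *m A *m V^T) = char_poly A.
Proof.
move=> Vo; rewrite /char_poly /char_poly_mx !map_mxM.
set V' := map_mx _ V; set A' := map_mx _ A; set V'T := map_mx _ V^T.
have Vo' : V' *m V'T = 1%:M by rewrite -map_mxM Vo map_mx1.
have -> : 'X%:M - V' *m A' *m V'T = V' *m ('X%:M - A') *m V'T.
  rewrite mulmxBr mulmxBl; congr (_ - _).
  by rewrite scalar_mxC -mulmxA Vo' mulmx1.
by rewrite !det_mulmx mulrC mulrA -det_mulmx (mulmx1C Vo') det1 mul1r.
Qed.

Lemma svd_char_poly (R : realDomainType) (n m : nat) (Z : 'M[R]_(n, m)) V W s :
  is_svd Z V W s -> char_poly (Z^T *m Z) =
    'X^(m - minn n m) * \prod_(a < minn n m) ('X - (s a ^+ 2)%:P).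
Proof.
move=> Zsvd; have [_ Wo _ sp _] := Zsvd.
have := svd_gram (is_svd_tr Zsvd); rewrite trmxK => ->.
rewrite char_poly_orthogonal_conj // char_poly_trig ?rect_diag_mx_trig //.
under eq_bigr do rewrite mxE eqxx mulr1n.
rewrite -(big_mkord xpredT (fun i => 'X - (s i ^+ 2)%:P)).
rewrite -(big_mkord xpredT (fun i => 'X - (s i ^+ 2)%:P)).
rewrite (@big_cat_nat _ _ _ (minn n m)) ?geq_minr //= mulrC; congr (_ * _).
rewrite big_nat_cond (eq_bigr (fun=> 'X)) => [|i]; last first.
  by rewrite andbT => /andP[pi _]; rewrite sp // expr0n subr0.
by rewrite -big_nat_cond prodr_const_nat.
Qed.

Lemma prod_XsubC_perm (F : fieldType) (p : nat) (f g : 'I_p -> F) :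
  \prod_a ('X - (f a)%:P) = \prod_a ('X - (g a)%:P) ->
  exists c : {perm 'I_p}, forall a, f a = g (c a).
Proof.
move=> fg; have : perm_eq [tuple f i | i < p] [tuple g i | i < p].
  apply: prod_XsubC_eq; rewrite !big_tuple.
  under eq_bigr do rewrite tnth_mktuple.
  by under [RHS]eq_bigr do rewrite tnth_mktuple.
case/tuple_permP => c /val_inj fc; exists c => a.
by have := congr1 (fun t => tnth t a) fc; rewrite !tnth_mktuple.
Qed.

Lemma sum_mxvec (V : nmodType) (n m : nat) (F : 'I_(n * m) -> V) :
  \sum_k F k = \sum_i \sum_j F (mxvec_index i j).
Proof.
rewrite (reindex _ (curry_mxvec_bij _ _)) pair_bigA /=.
by apply: eq_bigr => -[i j].
Qed.

(** Both sides are tr (Z Z^T). *)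
Lemma svd_sum_sqr (R : realDomainType) (n m : nat) (Z : 'M[R]_(n, m)) V W s :
  is_svd Z V W s ->
  \sum_(a < minn n m) s a ^+ 2 = \sum_(k < n * m) mxvec Z 0 k ^+ 2.
Proof.
move=> Zsvd; have [Vo _ _ sp _] := Zsvd.
have -> : \sum_(k < n * m) mxvec Z 0 k ^+ 2 = \tr (Z *m Z^T).
  rewrite sum_mxvec /mxtrace.
  apply: eq_bigr => i _; rewrite mxE; apply: eq_bigr => j _.
  by rewrite mxvecE mxE expr2.
rewrite (svd_gram Zsvd) mxtrace_mulC mulmxA (mulmx1C Vo) mul1mx /mxtrace.
under [RHS]eq_bigr do rewrite mxE eqxx mulr1n.
rewrite -(big_mkord xpredT (fun i => s i ^+ 2)).
rewrite -(big_mkord xpredT (fun i => s i ^+ 2)).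
rewrite [RHS](@big_cat_nat _ _ _ (minn n m)) ?geq_minl //=.
rewrite [X in _ = _ + X]big_nat_cond [X in _ = _ + X]big1 ?addr0 // => i.
by rewrite andbT => /andP[pi _]; rewrite sp // expr0n.
Qed.

(** * The chart and the Jordan angles *)

(** With the inverse square root of 1 + Z Z^T for L; it orthonormalizes the rows
eps_i + Sum_a z_ia eps_(n+a) without changing their orientation. *)
Lemma gram1_sqrt (R : rcfType) (n m : nat) (Z : 'M[R]_(n, m)) :
  exists L : 'M[R]_n, 0 < \det L /\ L *m (1%:M + Z *m Z^T) *m L^T = 1%:M.
Proof.
have [V [W [s Zsvd]]] := svd_exists Z; have [Vo _ _ _ _] := Zsvd.
pose r i := (Num.sqrt (1 + s i ^+ 2))^-1.
have s1 i : 0 < 1 + s i ^+ 2 by rewrite ltr_pwDl ?ltr01 ?sqr_ge0.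
have r0 i : 0 < r i by rewrite invr_gt0 sqrtr_gt0.
exists (V *m rect_diag_mx n n r *m V^T); split.
  rewrite !det_mulmx mulrAC -det_mulmx Vo det1 mul1r.
  rewrite det_trig ?rect_diag_mx_trig // prodr_gt0 // => i _.
  by rewrite mxE eqxx mulr1n.
have -> : (V *m rect_diag_mx n n r *m V^T)^T = V *m rect_diag_mx n n r *m V^T.
  by rewrite !trmx_mul trmxK tr_rect_diag_mx mulmxA.
rewrite (svd_gram1 Zsvd) orthogonal_conj_mul //.
rewrite orthogonal_conj_mul // !mul_rect_diag_sq.
rewrite (_ : rect_diag_mx _ _ _ = 1%:M) ?mulmx1 //.
rewrite -rect_diag_mx1; apply/matrixP => i j; rewrite !mxE; congr (_ *+ _).
by rewrite mulrAC -expr2 /r exprVn sqr_sqrtr ?ltW // mulVf ?gt_eqF.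
Qed.

Section Chart.
Context (R : realType) (n m : nat) (eps : oframe R (n + m) (n + m)).
Implicit Types (P : grass R n m) (Z : 'M[R]_(n, m)).

Lemma coord_surj Z : exists P, U eps P /\ coord eps P = Z.
Proof.
have [e11 e12 e21 e22] := eps_orthonormal eps.
have [L [L0 LZ]] := gram1_sqrt Z.
set F := (eps1 eps + Z *m eps2 eps)%R.
have FF : F *m F^T = 1%:M + Z *m Z^T.
  rewrite /F linearD /= trmx_mul mulmxDl !mulmxDr e11 mulmxA e12 mul0mx addr0.
  by rewrite -!mulmxA e21 mulmx0 add0r [eps2 eps *m _]mulmxA e22 mul1mx.
have Eo : (L *m F) *m (L *m F)^T == 1%:M.
  by rewrite trmx_mul mulmxA -(mulmxA L) FF LZ.
pose P := \pi_(grass R n m) (OFrame Eo).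
have /andP[/eqmxP rE dE] : same_plane (repr P) (OFrame Eo).
  have : P = \pi_(grass R n m) (OFrame Eo) by [].
  by rewrite -[LHS]reprK => /eqquotP.
have Lu : L \in unitmx by rewrite unitmxE unitfE gt_eqF.
have /submxP[A eA] : (ofmx (repr P) <= L *m F)%MS by rewrite rE /=.
have UP : U eps P.
  move: dE; rewrite /U /= /w eA /= -mulmxA (eqP Eo) mulmx1 => dA.
  rewrite -!mulmxA !det_mulmx mulr_gt0 // mulr_gt0 //.
  by rewrite /F mulmxDl -mulmxA e11 e21 mulmx0 addr0 det1.
exists P; split=> //; apply: spanned_by_uniq (coordP UP) _.
rewrite /spanned_by; apply/eqmxP; apply: eqmx_trans rE _ => /=.
by apply: eqmxMfull; rewrite row_full_unit.
Qed.

Lemma planeP Z : U eps (plane eps Z) /\ coord eps (plane eps Z) = Z.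
Proof. exact: (xgetPex _ (coord_surj Z)). Qed.

(** Jordan angles exist: take the arctangents of the singular values. *)
Lemma is_jordan_anglesP P : is_jordan_angles eps P (jordan_angle eps P).
Proof.
rewrite /jordan_angle; apply: xgetPex.
have [V [W [s Zsvd]]] := svd_exists (coord eps P); have [_ _ s0 _ _] := Zsvd.
exists (fun a => atan (s a)); split=> /= [a|].
  by rewrite atan_ltpi2 andbT -atan0 le_atan.
split=> [a|]; first by rewrite atanK.
under eq_bigr do rewrite atanK.
exact: svd_char_poly Zsvd.
Qed.

(** The tangents of the Jordan angles are the singular values up to order, since
both families give the roots of the same characteristic polynomial. *)
Lemma svd_jordan_angle P V W s : is_svd (coord eps P) V W s ->
  exists c : {perm 'I_(minn n m)},
    forall a, tan (jordan_angle eps P (c a)) = s a.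
Proof.
move=> Zsvd; have [_ _ s0 _ _] := Zsvd.
have [_ [t0 tE]] := is_jordan_anglesP P.
have : \prod_(a < minn n m) ('X - (s a ^+ 2)%:P) =
       \prod_a ('X - (tan (jordan_angle eps P a) ^+ 2)%:P).
  apply: (mulfI (monic_neq0 (monicXn R (m - minn n m)))).
  by rewrite -tE (svd_char_poly Zsvd).
case/prod_XsubC_perm => c cE; exists c => a.
by apply/eqP; rewrite -(eqrXn2 (isT : (0 < 2)%N)) // cE.
Qed.

Lemma u_svd P V W s : is_svd (coord eps P) V W s ->
  u eps P = \sum_(a < minn n m) s a ^+ 2.
Proof.
case/svd_jordan_angle => c cE; rewrite /u (reindex_inj (@perm_inj _ c)) /=.
by apply: eq_bigr => a _; rewrite cE.
Qed.

Lemma BJX_svd P V W s : is_svd (coord eps P) V W s -> BJX eps P ->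
  forall a b : 'I_(minn n m), a != b -> s a * s b < 1.
Proof.
move=> Zsvd [_ PB] a b ab; have [c cE] := svd_jordan_angle Zsvd.
have [th _] := is_jordan_anglesP P.
have := PB (c a) (c b); rewrite (inj_eq perm_inj) => /(_ ab).
rewrite -!cE; have := th (c a); have := th (c b).
(* tan x tan y < 1 is equivalent to cos (x + y) > 0. *)
move: (jordan_angle eps P (c a)) (jordan_angle eps P (c b)) => x y.
move=> /andP[y0 y1] /andP[x0 x1] xy.
have pi0 := pi_gt0 R.
have cx : 0 < cos x by apply: cos_gt0_pihalf; rewrite x1 andbT; lra.
have cy : 0 < cos y by apply: cos_gt0_pihalf; rewrite y1 andbT; lra.
have : 0 < cos (x + y) by apply: cos_gt0_pihalf; rewrite xy andbT; lra.
rewrite cosD /tan subr_gt0 mulf_div => h.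
by rewrite ltr_pdivrMr ?mulr_gt0 // mul1r.
Qed.

(** In the coordinates Z the function u is the polynomial tr (Z Z^T). *)
Lemma in_chart_u : in_chart eps (u eps) = fun z => \sum_k z 0 k ^+ 2.
Proof.
apply/funext => z; rewrite /in_chart.
have [V [W [s Zsvd]]] := svd_exists (coord eps (plane eps (vec_mx z))).
rewrite (u_svd Zsvd) (svd_sum_sqr Zsvd) (planeP (vec_mx z)).2.
by rewrite vec_mxK.
Qed.

End Chart.

(** * Directional derivatives of matrix-valued maps *)

Section MatrixDerivative.
Context (R : realType) (N : nat).
Implicit Types (x v : 'rV[R]_N).

Lemma is_derive_bigsum (k : nat) (h : 'I_k -> 'rV[R]_N -> R) x v
    (dh : 'I_k -> R) :
  (forall i, is_derive x v (h i) (dh i)) ->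
  is_derive x v (fun y => \sum_i h i y) (\sum_i dh i).
Proof.
move=> hd; have -> : (fun y => \sum_i h i y) = \sum_i h i.
  by apply/funext => y; rewrite fct_sumE.
exact: is_derive_sum.
Qed.

Lemma is_derive_prod (f g : 'rV[R]_N -> R) x v df dg :
  is_derive x v f df -> is_derive x v g dg ->
  is_derive x v (fun y => f y * g y) (f x * dg + g x * df).
Proof. by move=> fd gd; exact: is_deriveM. Qed.

Lemma is_derive_coord x v k : is_derive x v (fun y : 'rV[R]_N => y 0 k) (v 0 k).
Proof.
have d : derivable (id : 'rV[R]_N -> 'rV[R]_N) x v by exact: derivable_id.
have /derivable_mxP dk := d.
apply: DeriveDef; first exact: dk.
have := congr1 (fun M : 'rV[R]_N => M 0 k) (derive_mx d).
by rewrite /= derive_id mxE => ->.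
Qed.

(** dF is the entrywise derivative at x, in the direction v, of the matrix-valued
map F. *)
Definition is_mxderive (a b : nat) x v (F : 'rV[R]_N -> 'M[R]_(a, b))
    (dF : 'M[R]_(a, b)) : Prop :=
  forall i j, is_derive x v (fun y => F y i j) (dF i j).

Lemma is_mxderive_eq a b x v (F : 'rV[R]_N -> 'M[R]_(a, b)) dF dF' :
  is_mxderive x v F dF -> dF = dF' -> is_mxderive x v F dF'.
Proof. by move=> ? <-. Qed.

Lemma is_mxderive_unique a b x v (F : 'rV[R]_N -> 'M[R]_(a, b)) dF dF' :
  is_mxderive x v F dF -> is_mxderive x v F dF' -> dF = dF'.
Proof.
by move=> h h'; apply/matrixP => i j; case: (h i j) (h' i j) => ? <- [? <-].
Qed.

Lemma is_mxderive_cst a b x v (C : 'M[R]_(a, b)) : is_mxderive x v (fun=> C) 0.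
Proof. by move=> i j; rewrite mxE; exact: is_derive_cst. Qed.

Lemma is_mxderiveD a b x v (F G : 'rV[R]_N -> 'M[R]_(a, b)) dF dG :
  is_mxderive x v F dF -> is_mxderive x v G dG ->
  is_mxderive x v (fun y => F y + G y) (dF + dG).
Proof.
move=> Fd Gd i j; rewrite mxE.
have -> : (fun y => (F y + G y)%R i j) = (fun y => F y i j) + (fun y => G y i j).
  by apply/funext => y; rewrite mxE.
exact: is_deriveD.
Qed.

Lemma is_mxderive_tr a b x v (F : 'rV[R]_N -> 'M[R]_(a, b)) dF :
  is_mxderive x v F dF -> is_mxderive x v (fun y => (F y)^T) dF^T.
Proof.
move=> Fd i j; rewrite mxE; have -> : (fun y => (F y)^T i j) = (fun y => F y j i).
  by apply/funext => y; rewrite mxE.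
exact: Fd.
Qed.

Lemma is_mxderiveM a b c x v (F : 'rV[R]_N -> 'M[R]_(a, b))
    (G : 'rV[R]_N -> 'M[R]_(b, c)) dF dG :
  is_mxderive x v F dF -> is_mxderive x v G dG ->
  is_mxderive x v (fun y => F y *m G y) (dF *m G x + F x *m dG).
Proof.
move=> Fd Gd i j.
have -> : (fun y => (F y *m G y) i j) = (fun y => \sum_k F y i k * G y k j).
  by apply/funext => y; rewrite mxE.
have -> : (dF *m G x + F x *m dG) i j =
    \sum_k (F x i k * dG k j + G x k j * dF i k).
  rewrite !mxE -big_split /=; apply: eq_bigr => k _.
  by rewrite addrC [dF _ _ * _]mulrC.
by apply: is_derive_bigsum => k; apply: is_derive_prod.
Qed.

Lemma is_derive_mxtrace a x v (F : 'rV[R]_N -> 'M[R]_a) dF :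
  is_mxderive x v F dF -> is_derive x v (fun y => \tr (F y)) (\tr dF).
Proof. by move=> Fd; apply: is_derive_bigsum => i; exact: Fd. Qed.

(** By expansion along the first row. *)
Lemma derivable_det a x v (F : 'rV[R]_N -> 'M[R]_a) :
  (forall i j, derivable (fun y => F y i j) x v) ->
  derivable (fun y => \det (F y)) x v.
Proof.
elim: a F => [|a IHa] F Fd.
  rewrite (_ : (fun y => _) = cst 1); first exact: derivable_cst.
  by apply/funext => y; rewrite det_mx00.
rewrite (_ : (fun y => _) =
  (fun y => \sum_j F y ord0 j * cofactor (F y) ord0 j)); last first.
  by apply/funext => y; rewrite (expand_det_row _ ord0).
have h j : derivable (fun y => F y ord0 j * cofactor (F y) ord0 j) x v.
  apply: derivableM; first exact: Fd.
  apply: derivableM; first exact: derivable_cst.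
  apply: IHa => k l.
  rewrite (_ : (fun y => _) = fun y => F y (lift ord0 k) (lift j l)).
    exact: Fd.
  by apply/funext => y; rewrite !mxE.
by have [] := is_derive_bigsum (fun j => derivableP (h j)).
Qed.

(** Cramer's rule gives derivability; the value then comes from differentiating
F^-1 F = 1. *)
Lemma is_mxderiveV a x v (F : 'rV[R]_N -> 'M[R]_a) dF :
  (forall y, F y \in unitmx) -> is_mxderive x v F dF ->
  is_mxderive x v (fun y => invmx (F y)) (- (invmx (F x) *m dF *m invmx (F x))).
Proof.
move=> Fu Fd.
have Fd' i j : derivable (fun y => F y i j) x v by have [] := Fd i j.
have Vd i j : derivable (fun y => invmx (F y) i j) x v.
  rewrite (_ : (fun y => _) =
    (fun y => (\det (F y))^-1 * cofactor (F y) j i)); last first.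
    by apply/funext => y; rewrite /invmx Fu !mxE.
  apply: derivableM.
    apply: derivableV; last exact: derivable_det.
    by have := Fu x; rewrite unitmxE unitfE.
  apply: derivableM; first exact: derivable_cst.
  apply: derivable_det => k l.
  rewrite (_ : (fun y => _) = fun y => F y (lift j k) (lift i l)) //.
  by apply/funext => y; rewrite !mxE.
pose dV := \matrix_(i, j) 'D_v (fun y => invmx (F y) i j) x.
have Vd' : is_mxderive x v (fun y => invmx (F y)) dV.
  by move=> i j; rewrite mxE; exact: derivableP.
apply: (is_mxderive_eq Vd').
have := is_mxderiveM Vd' Fd.
rewrite (_ : (fun y => _) = fun=> 1%:M); last first.
  by apply/funext => y; rewrite mulVmx.
move=> /is_mxderive_unique/(_ (is_mxderive_cst x v _)) /eqP.
rewrite addr_eq0 => /eqP/(congr1 (mulmx^~ (invmx (F x)))).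
by rewrite mulmxK // mulNmx.
Qed.

End MatrixDerivative.

(** * Christoffel symbols and the Hessian of u *)

Section Metric.
Context (R : realType) (n m : nat).
Implicit Types (X Y W Z : 'M[R]_(n, m)) (z : 'rV[R]_(n * m)).

Local Notation gA Z := (invmx (1%:M + Z *m Z^T)).
Local Notation gB Z := (invmx (1%:M + Z^T *m Z)).

Lemma gram1_tr_unit Z : 1%:M + Z^T *m Z \in unitmx.
Proof. by rewrite -{2}[Z]trmxK gram1_unit. Qed.

Lemma gA_sym Z : (gA Z)^T = gA Z.
Proof. by rewrite trmx_inv linearD /= trmx1 trmx_mul trmxK. Qed.

Lemma gB_sym Z : (gB Z)^T = gB Z.
Proof. by rewrite trmx_inv linearD /= trmx1 trmx_mul trmxK. Qed.

Lemma tr_gA Z : Z^T *m gA Z = gB Z *m Z^T.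
Proof.
apply: (canLR (mulmxK (gram1_unit Z))).
rewrite -mulmxA; apply: (canRL (mulKmx (gram1_tr_unit Z))).
by rewrite mulmxDr mulmxDl mulmx1 mul1mx mulmxA.
Qed.

(** X Z^T (1 + Z Z^T)^-1 Y: the Christoffel symbols of the metric are given by
Gamma(X, Y) = - (gamma X Y + gamma Y X). *)
Definition gamma Z X Y : 'M[R]_(n, m) := X *m Z^T *m gA Z *m Y.

Lemma metric_sym Z X Y : canonical_metric Z X Y = canonical_metric Z Y X.
Proof.
rewrite /canonical_metric -mxtrace_tr !trmx_mul trmxK gA_sym gB_sym.
by rewrite !mulmxA mxtrace_mulC !mulmxA.
Qed.

(** The derivative of the metric in the direction v, applied to Y and W. The four
terms come from the two summands in the derivative of each of the factors
(1 + Z Z^T)^-1 and (1 + Z^T Z)^-1. *)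
Lemma is_derive_metric z v Y W :
  is_derive z v (fun y => canonical_metric (vec_mx y) Y W)
    (- (canonical_metric (vec_mx z) (gamma (vec_mx z) (vec_mx v) Y) W +
        canonical_metric (vec_mx z) (gamma (vec_mx z) Y (vec_mx v)) W +
        canonical_metric (vec_mx z) (gamma (vec_mx z) (vec_mx v) W) Y +
        canonical_metric (vec_mx z) (gamma (vec_mx z) W (vec_mx v)) Y)).
Proof.
have Zd : is_mxderive z v (fun y => vec_mx y : 'M[R]_(n, m))
    (vec_mx v : 'M[R]_(n, m)).
  move=> i j; rewrite mxE.
  rewrite (_ : (fun y => _) = fun y : 'rV[R]_(n * m) => y 0 (mxvec_index i j)).
    exact: is_derive_coord.
  by apply/funext => y; rewrite mxE.
have ZTd := is_mxderive_tr Zd.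
have Md := is_mxderiveD (is_mxderive_cst z v 1%:M) (is_mxderiveM Zd ZTd).
have MTd := is_mxderiveD (is_mxderive_cst z v 1%:M) (is_mxderiveM ZTd Zd).
have Ad := is_mxderiveV (fun y => gram1_unit (vec_mx y)) Md.
have Bd := is_mxderiveV (fun y => gram1_tr_unit (vec_mx y)) MTd.
have := is_derive_mxtrace (is_mxderiveM (is_mxderiveM (is_mxderiveM Ad
  (is_mxderive_cst z v Y)) Bd) (is_mxderive_cst z v W^T)).
rewrite /canonical_metric /=.
move: (vec_mx z) (vec_mx v) => Z X.
move=> h; apply: is_derive_eq h _.
rewrite !mulmx0 !addr0 !add0r /gamma.
set A := gA Z; set B := gB Z.
have hB : Z^T *m A = B *m Z^T := tr_gA Z.
have As : A^T = A := gA_sym Z.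
have Bs : B^T = B := gB_sym Z.
rewrite !mulmxDr !mulmxDl !(mulNmx, mulmxN) !mulmxDl.
rewrite !mxtraceD ?[\tr (- _)]raddfN /=.
(* Transposition and cyclicity of the trace, with Z^T A = B Z^T. *)
have t1 : \tr (A *m (X *m Z^T) *m A *m Y *m B *m W^T) =
    \tr (A *m (X *m Z^T *m A *m Y) *m B *m W^T) by rewrite !mulmxA.
have t2 : \tr (A *m (Z *m X^T) *m A *m Y *m B *m W^T) =
    \tr (A *m (X *m Z^T *m A *m W) *m B *m Y^T).
  rewrite -mxtrace_tr !trmx_mul !trmxK As Bs.
  transitivity (\tr (W *m B *m Y^T *m (A *m X *m Z^T *m A))).
    by rewrite !mulmxA.
  by rewrite mxtrace_mulC !mulmxA.
have t3 : \tr (A *m Y *m (B *m (X^T *m Z) *m B) *m W^T) =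
    \tr (A *m (W *m Z^T *m A *m X) *m B *m Y^T).
  rewrite -mxtrace_tr !trmx_mul !trmxK As Bs.
  transitivity (\tr (W *m (B *m Z^T) *m X *m B *m Y^T *m A)).
    by rewrite !mulmxA.
  by rewrite mxtrace_mulC -hB !mulmxA.
have t4 : \tr (A *m Y *m (B *m (Z^T *m X) *m B) *m W^T) =
    \tr (A *m (Y *m Z^T *m A *m X) *m B *m W^T).
  transitivity (\tr (A *m Y *m (B *m Z^T) *m X *m B *m W^T)).
    by rewrite !mulmxA.
  by rewrite -hB !mulmxA.
rewrite mulmxDr mulmxDl !mxtraceD t1 t2 t3 t4.
by ring.
Qed.

Lemma metric_suml (I : finType) (c : I -> R) (E : I -> 'M[R]_(n, m)) Z Y :
  canonical_metric Z (\sum_i c i *: E i) Y =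
  \sum_i c i * canonical_metric Z (E i) Y.
Proof.
rewrite /canonical_metric mulmx_sumr !mulmx_suml raddf_sum /=.
by apply: eq_bigr => i _; rewrite -scalemxAr -!scalemxAl mxtraceZ.
Qed.

Lemma metricN Z X Y : canonical_metric Z (- X) Y = - canonical_metric Z X Y.
Proof. by rewrite /canonical_metric mulmxN !mulNmx raddfN. Qed.

Lemma metricD Z X X' Y :
  canonical_metric Z (X + X') Y =
  canonical_metric Z X Y + canonical_metric Z X' Y.
Proof. by rewrite /canonical_metric mulmxDr !mulmxDl mxtraceD. Qed.

Lemma vec_mx_sum (v : 'rV[R]_(n * m)) :
  vec_mx v = \sum_k v 0 k *: vec_mx (delta_mx 0 k) :> 'M[R]_(n, m).
Proof.
rewrite {1}[v]row_sum_delta raddf_sum /=.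
by apply: eq_bigr => k _; rewrite linearZ.
Qed.

Lemma mxtrace_mul_delta X i j : \tr (X *m (delta_mx i j)^T) = X i j.
Proof.
rewrite /mxtrace (bigD1 i) //= [X in _ + X]big1 ?addr0 => [|k ki].
  rewrite mxE (bigD1 j) //= [X in _ + X]big1 ?addr0 => [|l lj].
    by rewrite !mxE !eqxx mulr1.
  by rewrite !mxE (negPf lj) andbF mulr0.
by rewrite mxE big1 // => l _; rewrite !mxE (negPf ki) mulr0.
Qed.

Lemma metric_nondegenerate Z X :
  (forall Y, canonical_metric Z X Y = 0) -> X = 0.
Proof.
move=> X0; have AXB : gA Z *m X *m gB Z = 0.
  apply/matrixP => i j; rewrite [RHS]mxE -(X0 (delta_mx i j)).
  by rewrite /canonical_metric mxtrace_mul_delta.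
have Au : gA Z \in unitmx by rewrite unitmx_inv gram1_unit.
have Bu : gB Z \in unitmx by rewrite unitmx_inv gram1_tr_unit.
by rewrite -[X](mulKmx Au) -[gA Z *m X](mulmxK Bu) AXB mul0mx mulmx0.
Qed.

Lemma metric_components_mulE z (v : 'rV[R]_(n * m)) (k : 'I_(n * m)) :
  (v *m metric_components z) 0 k =
  canonical_metric (vec_mx z) (vec_mx v) (vec_mx (delta_mx 0 k)).
Proof.
rewrite (vec_mx_sum v) metric_suml mxE.
by apply: eq_bigr => i _; rewrite mxE.
Qed.

Lemma metric_components_unit z : metric_components z \in unitmx.
Proof.
rewrite -row_free_unit -kermx_eq0; apply/eqP/row_matrixP => i; rewrite row0.
set v := row i _; have v0 : v *m metric_components z = 0.
  by rewrite /v -row_mul mulmx_ker row0.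
apply: (can_inj vec_mxK); rewrite raddf0.
apply: (@metric_nondegenerate (vec_mx z)) => Y.
rewrite metric_sym -[Y]mxvecK (vec_mx_sum (mxvec Y)) metric_suml big1 // => k _.
by rewrite metric_sym -metric_components_mulE v0 mxE mulr0.
Qed.

Lemma metric_components_sym z : (metric_components z)^T = metric_components z.
Proof. by apply/matrixP => i j; rewrite !mxE metric_sym. Qed.

Local Notation e k := (vec_mx (delta_mx 0 k) : 'M[R]_(n, m)).

(** The metric being nondegenerate, the Christoffel symbols are determined by the
Koszul formula, in which eight of the twelve terms of [is_derive_metric]
cancel. *)
Lemma christoffel_gamma z (k i j : 'I_(n * m)) :
  christoffel (@metric_components R n m) z k i j =
  - mxvec (gamma (vec_mx z) (e i) (e j) + gamma (vec_mx z) (e j) (e i)) 0 k.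
Proof.
set G := @metric_components R n m; set Z := vec_mx z.
pose c : 'rV[R]_(n * m) := - mxvec (gamma Z (e i) (e j) + gamma Z (e j) (e i)).
pose d : 'rV[R]_(n * m) := \row_l christoffel G z l i j.
have Gsym : (G z)^T = G z := metric_components_sym z.
have Gu : G z \in unitmx := metric_components_unit z.
(* G z being invertible, it suffices to compare after lowering the index k. *)
suff : d *m G z = c *m G z.
  move=> /(can_inj (mulmxK Gu)) /rowP/(_ k).
  by rewrite [LHS]mxE [RHS]mxE.
apply/rowP => l; rewrite [RHS]metric_components_mulE -/Z.
have -> : (d *m G z) 0 l = \sum_q G z l q * christoffel G z q i j.
  rewrite mxE; apply: eq_bigr => q _.
  by rewrite mxE mulrC -[in RHS]Gsym [in RHS]mxE.
rewrite christoffel_lower // /c linearN /= mxvecK metricN metricD.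
have pd a b r : partial a (fun y => G y b r) z =
    - (canonical_metric Z (gamma Z (e a) (e b)) (e r) +
       canonical_metric Z (gamma Z (e b) (e a)) (e r) +
       canonical_metric Z (gamma Z (e a) (e r)) (e b) +
       canonical_metric Z (gamma Z (e r) (e a)) (e b)).
  rewrite /partial (_ : (fun y => _) =
    fun y => canonical_metric (vec_mx y) (e b) (e r)); last first.
    by apply/funext => y; rewrite mxE.
  by have [_ ->] := is_derive_metric z (delta_mx 0 a) (e b) (e r).
by rewrite !pd; field.
Qed.

Lemma is_derive_sum_sqr (N : nat) (x v : 'rV[R]_N) :
  is_derive x v (fun y : 'rV[R]_N => \sum_k y 0 k ^+ 2)
    (2 * \sum_k x 0 k * v 0 k).
Proof.
rewrite mulr_sumr; apply: is_derive_bigsum => k.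
rewrite (_ : (fun y => _) = fun y : 'rV[R]_N => y 0 k * y 0 k); last first.
  by apply/funext => y; rewrite expr2.
apply: is_derive_eq.
  by apply: is_derive_prod; exact: is_derive_coord.
by rewrite mulr_natl mulr2n.
Qed.

Lemma sum_delta_mx (N : nat) (x : 'rV[R]_N) j :
  \sum_k x 0 k * (delta_mx 0 j : 'rV[R]_N) 0 k = x 0 j.
Proof.
rewrite (bigD1 j) //= mxE !eqxx mulr1 big1 ?addr0 // => k kj.
by rewrite mxE (negPf kj) andbF mulr0.
Qed.

Lemma partial_sum_sqr (N : nat) j :
  partial j (fun y : 'rV[R]_N => \sum_k y 0 k ^+ 2) = fun y => 2 * y 0 j.
Proof.
apply/funext => y; rewrite /partial.
have [_ ->] := is_derive_sum_sqr y (delta_mx 0 j).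
by rewrite sum_delta_mx.
Qed.

Lemma partial_partial_sum_sqr (N : nat) i j (x : 'rV[R]_N) :
  partial i (partial j (fun y : 'rV[R]_N => \sum_k y 0 k ^+ 2)) x = 2 *+ (i == j).
Proof.
rewrite partial_sum_sqr /partial.
have [_ ->] := is_derive_prod (is_derive_cst (2 : R) x (delta_mx 0 i))
  (is_derive_coord x (delta_mx 0 i) j).
by rewrite mulr0 addr0 mxE eqxx /= eq_sym mulr_natr.
Qed.

Lemma sum_mxvec_mul (X Y : 'M[R]_(n, m)) :
  \sum_k mxvec X 0 k * mxvec Y 0 k = \tr (X *m Y^T).
Proof.
rewrite sum_mxvec /mxtrace; apply: eq_bigr => i _; rewrite mxE.
by apply: eq_bigr => j _; rewrite !mxvecE mxE.
Qed.

Lemma gamma_bilinear Z X Y :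
  gamma Z X Y = \sum_i \sum_j (mxvec X 0 i * mxvec Y 0 j) *: gamma Z (e i) (e j).
Proof.
rewrite -[X in LHS]mxvecK -[Y in LHS]mxvecK.
rewrite (vec_mx_sum (mxvec X)) (vec_mx_sum (mxvec Y)) /gamma !mulmx_suml.
apply: eq_bigr => i _; rewrite mulmx_sumr; apply: eq_bigr => j _.
by rewrite -!scalemxAl -scalemxAr scalerA.
Qed.

(** Hess u (X, X) = 2 tr (X X^T) + 4 tr (X Z^T (1 + Z Z^T)^-1 X Z^T). *)
Lemma hessian_sum_sqr z (X : 'M[R]_(n, m)) :
  hessian (@metric_components R n m) (fun y => \sum_k y 0 k ^+ 2) z
    (mxvec X) (mxvec X) =
  2 * \tr (X *m X^T) + 4 * \tr (gamma (vec_mx z) X X *m (vec_mx z)^T).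
Proof.
set Z := vec_mx z; pose c i j := \tr (gamma Z (e i) (e j) *m Z^T).
have GammaE i j : \sum_k christoffel (@metric_components R n m) z k i j *
    partial k (fun y => \sum_k y 0 k ^+ 2) z = - 2 * (c i j + c j i).
  rewrite /c -mxtraceD -mulmxDl -sum_mxvec_mul mulr_sumr.
  apply: eq_bigr => k _; rewrite christoffel_gamma partial_sum_sqr /Z vec_mxK.
  by ring.
have cE : \sum_i \sum_j mxvec X 0 i * mxvec X 0 j * c i j =
    \tr (gamma Z X X *m Z^T).
  rewrite [in RHS]gamma_bilinear mulmx_suml raddf_sum /=.
  apply: eq_bigr => i _; rewrite mulmx_suml raddf_sum /=.
  by apply: eq_bigr => j _; rewrite -scalemxAl mxtraceZ.
rewrite /hessian -cE -sum_mxvec_mul.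
under eq_bigr => i _ do under eq_bigr => j _ do
  rewrite GammaE partial_partial_sum_sqr.
have -> : \sum_i \sum_j mxvec X 0 i * mxvec X 0 j *
    (2 *+ (i == j) - - 2 * (c i j + c j i)) =
  \sum_i 2 * (mxvec X 0 i * mxvec X 0 i) +
  \sum_i \sum_j 2 * (mxvec X 0 i * mxvec X 0 j * c i j) +
  \sum_i \sum_j 2 * (mxvec X 0 j * mxvec X 0 i * c j i).
  rewrite -!big_split /=; apply: eq_bigr => i _.
  rewrite -addrA -big_split /=.
  have -> : 2 * (mxvec X 0 i * mxvec X 0 i) =
      \sum_j (mxvec X 0 i * mxvec X 0 j * (2 *+ (i == j))).
    rewrite (bigD1 i) //= eqxx big1 => [|j]; first by rewrite mulr1n; ring.
    by rewrite eq_sym => /negPf->; rewrite mulr0.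
  rewrite -big_split /=; apply: eq_bigr => j _.
  by ring.
rewrite [X in _ + X]exchange_big /= -!addrA -mulr2n.
rewrite !mulr_sumr; congr (_ + _).
rewrite -sumrMnl; apply: eq_bigr => i _.
rewrite !mulr_sumr -sumrMnl; apply: eq_bigr => j _.
by ring.
Qed.

End Metric.

(** * Quadratic forms in singular bases *)

Lemma sum_ord_widen (V : nmodType) (n N : nat) (F : nat -> V) :
  (n <= N)%N -> (forall i, (n <= i)%N -> F i = 0) ->
  \sum_(i < n) F i = \sum_(i < N) F i.
Proof.
move=> nN F0; rewrite (big_ord_widen _ F nN) big_mkcond /=.
by apply: eq_bigr => i _; case: ltnP => // /F0.
Qed.

Lemma sum_ord_widen2 (V : nmodType) (n m N : nat) (F : nat -> nat -> V) :
  (n <= N)%N -> (m <= N)%N ->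
  (forall i j, (n <= i)%N -> F i j = 0) ->
  (forall i j, (m <= j)%N -> F i j = 0) ->
  \sum_(i < n) \sum_(j < m) F i j = \sum_(i < N) \sum_(j < N) F i j.
Proof.
move=> nN mN Fn Fm.
rewrite (@sum_ord_widen _ n N (fun i => \sum_(j < m) F i j)) //.
  by apply: eq_bigr => i _; apply: sum_ord_widen => // j; apply: Fm.
by move=> i ni; rewrite big1 // => j _; apply: Fn.
Qed.

(** The entries of Y, extended by 0 to all pairs of natural numbers: this lets an
entry and its transposed entry be compared when Y is not square. *)
Definition mx_ext (R : nmodType) (n m : nat) (Y : 'M[R]_(n, m)) (i j : nat) : R :=
  if insub i is Some i' then if insub j is Some j' then Y i' j' else 0 else 0.

Lemma mx_extE (R : nmodType) (n m : nat) (Y : 'M[R]_(n, m)) (i : 'I_n)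
    (j : 'I_m) :
  mx_ext Y i j = Y i j.
Proof. by rewrite /mx_ext !valK. Qed.

Lemma mx_ext_row0 (R : nmodType) (n m : nat) (Y : 'M[R]_(n, m)) i j :
  (n <= i)%N -> mx_ext Y i j = 0.
Proof. by move=> ni; rewrite /mx_ext insubF // ltnNge ni. Qed.

Lemma mx_ext_col0 (R : nmodType) (n m : nat) (Y : 'M[R]_(n, m)) i j :
  (m <= j)%N -> mx_ext Y i j = 0.
Proof.
move=> mj; rewrite /mx_ext; case: insub => // a.
by rewrite insubF // ltnNge mj.
Qed.

Lemma mul_tr_rect_diagE (R : pzRingType) (n m : nat) (s : nat -> R)
    (Y : 'M[R]_(n, m)) (i j : 'I_n) :
  (Y *m (rect_diag_mx n m s)^T) i j = mx_ext Y i j * s j.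
Proof.
rewrite mxE; have [jm|mj] := ltnP j m; last first.
  rewrite mx_ext_col0 // mul0r big1 // => k _; rewrite !mxE.
  case: eqVneq => [jk|_]; last by rewrite mulr0n mulr0.
  by have := ltn_ord k; rewrite -jk ltnNge mj.
rewrite (bigD1 (Ordinal jm)) //= big1 => [|k kj].
  by rewrite !mxE /= eqxx mulr1n addr0 -mx_extE.
rewrite !mxE; case: eqVneq => [jk|_]; last by rewrite mulr0n mulr0.
by case/eqP: kj; apply/val_inj.
Qed.

Section SvdForms.
Context (R : realType) (n m : nat).
Implicit Types (X Y Z : 'M[R]_(n, m)).

Lemma mxtrace_sqr X : \tr (X *m X^T) = \sum_i \sum_j X i j ^+ 2.
Proof.
rewrite /mxtrace; apply: eq_bigr => i _; rewrite mxE; apply: eq_bigr => j _.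
by rewrite mxE expr2.
Qed.

(** In the orthonormal bases of a singular value decomposition of Z, every
quadratic form involved becomes explicit in the entries y of V^T X W. *)
Lemma svd_forms Z V W s X : is_svd Z V W s ->
  exists y : nat -> nat -> R,
  [/\ forall i, (minn n m <= i)%N -> y i i = 0,
      \tr (X *m X^T) = \sum_(i < maxn n m) \sum_(j < maxn n m) y i j ^+ 2,
      \tr (gamma Z X X *m Z^T) = \sum_(i < maxn n m) \sum_(j < maxn n m)
        s i * s j / (1 + s j ^+ 2) * (y i j * y j i),
      canonical_metric Z X X = \sum_(i < maxn n m) \sum_(j < maxn n m)
        y i j ^+ 2 / ((1 + s i ^+ 2) * (1 + s j ^+ 2))
    & \tr (Z *m X^T) = \sum_(a < minn n m) s a * y a a].
Proof.
move=> Zsvd; have [Vo Wo _ sp ZE] := Zsvd.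
have Vo' := mulmx1C Vo; have Wo' := mulmx1C Wo.
pose Y := V^T *m X *m W.
have XE : X = V *m Y *m W^T.
  by rewrite /Y !mulmxA Vo mul1mx -mulmxA Wo mulmx1.
have nN := leq_maxl n m; have mN := leq_maxr n m.
have sn i : (n <= i)%N -> s i = 0 by move=> ni; apply: sp; rewrite geq_min ni.
have VK (k : nat) (M : 'M[R]_(n, k)) : V^T *m (V *m M) = M.
  by rewrite mulmxA Vo' mul1mx.
have WK (k : nat) (M : 'M[R]_(m, k)) : W^T *m (W *m M) = M.
  by rewrite mulmxA Wo' mul1mx.
have XT : X^T = W *m Y^T *m V^T by rewrite XE !trmx_mul trmxK mulmxA.
have ZT : Z^T = W *m (rect_diag_mx n m s)^T *m V^T.
  by rewrite ZE !trmx_mul trmxK mulmxA.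
clearbody Y; exists (mx_ext Y); split.
- move=> i; rewrite geq_min => /orP[ni|mi].
    by rewrite mx_ext_row0.
  by rewrite mx_ext_col0.
- rewrite XT {1}XE -!mulmxA WK mxtrace_mulC -!mulmxA Vo' mulmx1 mxtrace_sqr.
  rewrite -(@sum_ord_widen2 _ n m _ (fun i j => mx_ext Y i j ^+ 2)) //.
  + by apply: eq_bigr => i _; apply: eq_bigr => j _; rewrite mx_extE.
  + by move=> i j ni; rewrite mx_ext_row0 // expr0n.
  + by move=> i j ni; rewrite mx_ext_col0 // expr0n.
- have -> : \tr (gamma Z X X *m Z^T) = \tr ((Y *m (rect_diag_mx n m s)^T) *m
      (rect_diag_mx n n (fun i => (1 + s i ^+ 2)^-1) *m
        (Y *m (rect_diag_mx n m s)^T))).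
    rewrite /gamma (svd_invmx_gram1 Zsvd) ZT XE -!mulmxA.
    by rewrite !(VK, WK) mxtrace_mulC -!mulmxA Vo' mulmx1.
  rewrite -(@sum_ord_widen2 _ n n _ (fun i j => s i * s j / (1 + s j ^+ 2) *
    (mx_ext Y i j * mx_ext Y j i))) //; last 2 first.
  + by move=> i j ni; rewrite mx_ext_row0 // mul0r mulr0.
  + by move=> i j ni; rewrite (@mx_ext_row0 _ _ _ _ j) // !mulr0.
  rewrite /mxtrace; apply: eq_bigr => i _; rewrite mxE; apply: eq_bigr => j _.
  by rewrite rect_diag_mulE !mul_tr_rect_diagE; ring.
- have Zsvd' := svd_invmx_gram1 (is_svd_tr Zsvd); rewrite trmxK in Zsvd'.
  have -> : canonical_metric Z X X =
      \tr (rect_diag_mx n n (fun i => (1 + s i ^+ 2)^-1) *m Y *m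
           rect_diag_mx m m (fun i => (1 + s i ^+ 2)^-1) *m Y^T).
    rewrite /canonical_metric (svd_invmx_gram1 Zsvd) Zsvd' XT XE -!mulmxA.
    by rewrite !(VK, WK) mxtrace_mulC -!mulmxA Vo' mulmx1.
  rewrite -(@sum_ord_widen2 _ n m _
    (fun i j => mx_ext Y i j ^+ 2 / ((1 + s i ^+ 2) * (1 + s j ^+ 2)))) //.
  + rewrite /mxtrace; apply: eq_bigr => i _; rewrite mxE; apply: eq_bigr => j _.
    rewrite mul_rect_diagE rect_diag_mulE mx_extE [Y^T _ _]mxE.
    have h1 := onesq_neq0 (s i); have h2 := onesq_neq0 (s j).
    by field; rewrite h1 h2.
  + by move=> i j ni; rewrite mx_ext_row0 // expr0n mul0r.
  + by move=> i j ni; rewrite mx_ext_col0 // expr0n mul0r.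
have -> : \tr (Z *m X^T) = \tr (Y *m (rect_diag_mx n m s)^T).
  rewrite -mxtrace_tr trmx_mul trmxK ZT XE -!mulmxA WK.
  by rewrite mxtrace_mulC -!mulmxA Vo' mulmx1.
rewrite (@sum_ord_widen _ _ n (fun a => s a * mx_ext Y a a)) ?geq_minl //.
  by apply: eq_bigr => i _; rewrite mul_tr_rect_diagE mulrC.
by move=> i pi; rewrite sp // mul0r.
Qed.

End SvdForms.

(** The Hessian is bounded below by a diagonal form. Each pair of transposed
entries is decoupled by - 2 y_ij y_ji <= y_ij^2 + y_ji^2; on the diagonal nothing
is lost. *)
Lemma hess_form_ge (R : realFieldType) (N : nat) (s : nat -> R)
    (y : nat -> nat -> R) : (forall i, 0 <= s i) ->
  \sum_(i < N) \sum_(j < N)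
     (2 + 2 * (if i == j then cross (s i) (s j) else - cross (s i) (s j)))
       * y i j ^+ 2
  <= 2 * (\sum_(i < N) \sum_(j < N) y i j ^+ 2) +
     4 * \sum_(i < N) \sum_(j < N) s i * s j / (1 + s j ^+ 2) * (y i j * y j i).
Proof.
move=> s0; pose c i j := cross (s i) (s j).
pose e (i j : 'I_N) := if i == j then c i j else - c i j.
have e_sym i j : e i j = e j i by rewrite /e eq_sym /c cross_sym.
pose a (i j : 'I_N) := s i * s j / (1 + s j ^+ 2) * (y i j * y j i).
have aE : 4 * (\sum_(i < N) \sum_(j < N) a i j) =
    \sum_(i < N) \sum_(j < N) 2 * c i j * (y i j * y j i).
  have -> : 4 * (\sum_(i < N) \sum_(j < N) a i j) =
      \sum_(i < N) \sum_(j < N) 2 * a i j + \sum_(i < N) \sum_(j < N) 2 * a j i.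
    have -> : \sum_(i < N) \sum_(j < N) 2 * a i j =
        2 * (\sum_(i < N) \sum_(j < N) a i j).
      by rewrite mulr_sumr; apply: eq_bigr => i _; rewrite mulr_sumr.
    have -> : \sum_(i < N) \sum_(j < N) 2 * a j i =
        2 * (\sum_(i < N) \sum_(j < N) a i j).
      rewrite exchange_big mulr_sumr; apply: eq_bigr => i _.
      by rewrite mulr_sumr.
    by rewrite -mulrDl -natrD.
  rewrite -big_split /=; apply: eq_bigr => i _.
  rewrite -big_split /=; apply: eq_bigr => j _.
  by rewrite /a /c /cross; ring.
have eE : \sum_(i < N) \sum_(j < N) 2 * e i j * y i j ^+ 2 =
    \sum_(i < N) \sum_(j < N) e i j * (y i j ^+ 2 + y j i ^+ 2).
  have -> : \sum_(i < N) \sum_(j < N) 2 * e i j * y i j ^+ 2 =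
      \sum_(i < N) \sum_(j < N) e i j * y i j ^+ 2 +
      \sum_(i < N) \sum_(j < N) e j i * y i j ^+ 2.
    rewrite -big_split /=; apply: eq_bigr => i _.
    rewrite -big_split /=; apply: eq_bigr => j _.
    by rewrite (e_sym j i); ring.
  rewrite [X in _ + X]exchange_big /= -big_split /=; apply: eq_bigr => i _.
  by rewrite -big_split /=; apply: eq_bigr => j _; ring.
rewrite aE mulr_sumr -big_split /=.
have -> : \sum_(i < N) \sum_(j < N)
     (2 + 2 * (if i == j then cross (s i) (s j) else - cross (s i) (s j)))
       * y i j ^+ 2 =
   \sum_(i < N) \sum_(j < N) 2 * y i j ^+ 2 +
   \sum_(i < N) \sum_(j < N) 2 * e i j * y i j ^+ 2.
  rewrite -big_split /=; apply: eq_bigr => i _.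
  rewrite -big_split /=; apply: eq_bigr => j _.
  by rewrite -/(c i j) -/(e i j); ring.
rewrite eE -big_split /=; apply: ler_sum => i _.
rewrite mulr_sumr lerD2l; apply: ler_sum => j _; rewrite /e.
case: eqVneq => [->|_].
  by rewrite le_eqVlt; apply/orP; left; apply/eqP; ring.
have := mulr_ge0 (cross_ge0 (s0 i) (s0 j)) (sqr_ge0 (y i j + y j i)).
by rewrite -/(c i j); nra.
Qed.

Lemma ler_sum_diag (R : numDomainType) (N : nat) (F : 'I_N -> 'I_N -> R) :
  (forall i j, i != j -> 0 <= F i j) ->
  \sum_i F i i <= \sum_i \sum_j F i j.
Proof.
move=> F0; apply: ler_sum => i _; rewrite (bigD1 i) //= lerDl sumr_ge0 // => j ji.
by apply: F0; rewrite eq_sym.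
Qed.

(** No bound on i and j is needed, as s vanishes from p on. *)
Lemma sum_pair_le (R : realDomainType) (p N : nat) (s : nat -> R) (i j : 'I_N) :
  (forall i, (p <= i)%N -> s i = 0) -> i != j ->
  s i ^+ 2 + s j ^+ 2 <= \sum_(a < p) s a ^+ 2.
Proof.
move=> sp ij; have pN := leq_maxl p N; have NN := leq_maxr p N.
rewrite (@sum_ord_widen _ p (maxn p N) (fun a => s a ^+ 2)) //; last first.
  by move=> a pa; rewrite sp // expr0n.
rewrite (bigD1 (widen_ord NN i)) //= lerD2l (bigD1 (widen_ord NN j)) /=.
  by rewrite lerDl sumr_ge0 // => a _; exact: sqr_ge0.
by rewrite -val_eqE /= val_eqE eq_sym.
Qed.

Section HessU.
Context (R : realType) (n m : nat) (eps : oframe R (n + m) (n + m)).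
Implicit Types (P : grass R n m) (X : 'M[R]_(n, m)).

Lemma Hess_uE P X : Hess eps (u eps) P X X =
  2 * \tr (X *m X^T) +
  4 * \tr (gamma (coord eps P) X X *m (coord eps P)^T).
Proof. by rewrite /Hess in_chart_u hessian_sum_sqr mxvecK. Qed.

Lemma differential_uE P X :
  differential eps (u eps) P X = 2 * \tr (coord eps P *m X^T).
Proof.
rewrite /differential in_chart_u.
by have [_ ->] := is_derive_sum_sqr (mxvec (coord eps P)) (mxvec X);
  rewrite sum_mxvec_mul.
Qed.

Lemma u_convex P X : BJX eps P -> 0 <= Hess eps (u eps) P X X.
Proof.
move=> PB; have [V [W [s Zsvd]]] := svd_exists (coord eps P).
have [_ _ s0 sp _] := Zsvd.
have [y [_ y2 yG _ _]] := svd_forms X Zsvd.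
rewrite Hess_uE y2 yG; apply: le_trans (hess_form_ge _ _ s0).
apply: sumr_ge0 => i _; apply: sumr_ge0 => j _; rewrite mulr_ge0 ?sqr_ge0 //.
case: eqVneq => [->|ij]; first by have := cross_ge0 (s0 j) (s0 j); lra.
suff : cross (s i) (s j) <= 1 by lra.
apply: cross_le1 => //.
have [ip|pi] := ltnP i (minn n m); last by rewrite sp ?mul0r ?ler01.
have [jp|pj] := ltnP j (minn n m); last by rewrite (sp j) ?mulr0 ?ler01.
by apply/ltW/(BJX_svd Zsvd PB (a := Ordinal ip) (b := Ordinal jp)).
Qed.

Lemma Hess_u_ge P X : (0 < minn n m)%N -> u eps P <= 2 ->
  (2 - 2^-1 * u eps P ^+ 2) * g eps P X X
  + ((3 + 4^-1 * (minn n m)%:R ^+ 2) * u eps P + 4 * (minn n m)%:R)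
      / (2 * (u eps P + (minn n m)%:R) ^+ 2)
    * differential eps (u eps) P X ^+ 2
  <= Hess eps (u eps) P X X.
Proof.
move=> p0 u2; have [V [W [s Zsvd]]] := svd_exists (coord eps P).
have [_ _ s0 sp _] := Zsvd.
have [y [yp y2 yG yg yd]] := svd_forms X Zsvd.
rewrite Hess_uE differential_uE /g y2 yG yg yd.
apply: le_trans (hess_form_ge _ _ s0).
rewrite (u_svd Zsvd) in u2 *.
have hd := @diag_bound R _ (fun a => s a) (fun a => y a a) p0 u2.
set v := \sum_(a < _) s a ^+ 2 in u2 hd *; set D := _ * (_ * _) ^+ 2 in hd *.
set k := 2 - _ in hd *.
rewrite -lerBrDl mulr_sumr -sumrB.
under eq_bigr do rewrite mulr_sumr -sumrB.
apply: le_trans (ler_sum_diag _); last first.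
  move=> i j ij; rewrite (negPf ij).
  have := cross_bound (s0 i) (s0 j) (sum_pair_le sp ij) u2; rewrite -/v -/k => h.
  have {h} : 0 <= (2 - 2 * cross (s i) (s j) -
      k / ((1 + s i ^+ 2) * (1 + s j ^+ 2))) * y i j ^+ 2.
    by rewrite mulr_ge0 ?sqr_ge0 // subr_ge0.
  by move: (_^-1) => q; rewrite (mulrC _ q) mulrA; lra.
under eq_bigr do rewrite eqxx -expr2.
rewrite -(@sum_ord_widen _ (minn n m) _ (fun i =>
  (2 + 2 * cross (s i) (s i)) * y i i ^+ 2
  - k * (y i i ^+ 2 / (1 + s i ^+ 2) ^+ 2))).
- by rewrite sumrB lerBrDl.
- by rewrite (leq_trans (geq_minl n m)) ?leq_maxl.
- by move=> i pi; rewrite yp // expr0n mul0r !mulr0 subr0.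
Qed.

End HessU.

Theorem proposition3p2 (R : realType) (n m : nat) (n_gt0 : (0 < n)%N)
    (m_gt0 : (0 < m)%N) (eps : oframe R (n + m) (n + m)) :
  let p : R := (minn n m)%:R in
  (forall P : grass R n m, BJX eps P ->
     forall X : 'M[R]_(n, m), 0 <= Hess eps (u eps) P X X) /\
  (forall P : grass R n m, U eps P -> u eps P <= 2 ->
     forall X : 'M[R]_(n, m),
     (2 - 2^-1 * u eps P ^+ 2) * g eps P X X
     + ((3 + 4^-1 * p ^+ 2) * u eps P + 4 * p) / (2 * (u eps P + p) ^+ 2)
       * differential eps (u eps) P X ^+ 2
     <= Hess eps (u eps) P X X).
Proof.
split=> [P PB X|P _ u2 X]; first exact: u_convex.
by apply: Hess_u_ge; rewrite // leq_min n_gt0.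
Qed.
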